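(* Let $0<\alpha<1/100$, $D^2Q<x^{\frac23-4\alpha}$, and $M_2\le x^{\frac13}$. Let $\kappa>0$ be a fixed real number. For all but at most $Q^{1-4\kappa+o(1)}$ integers $q\in[Q,2Q]$, $$\max_{(a,q)=1}|\mathcal D_{\mathcal M,f}(a,q)|\ll D^3x^\varepsilon\left(M_2^{\frac54}x^{\frac14}Q^{-\frac14}+M_2^{\frac34}x^{\frac14}\right)Q^{2\alpha+\kappa}+\frac{x}{Q^{1+\frac{\alpha}{2}}}$$ for any $\varepsilon$ with $0<\varepsilon<\alpha/4$.
   Context: Setting: $x$ is large; $\chi$ is an exceptional character of conductor $D$, i.e. a quadratic primitive Dirichlet character modulo $D$ such that $L(s,\chi)$ has a real zero $\beta\ge 1-C/\log(2D)$ for a fixed small constant $C>0$. For $i=1,2,3$ let $\mathcal M_i=[M_i,M_i(1+\Delta))$, where $0<\Delta\ll\frac{1}{\log^8x}$, and the real numbers $M_1,M_2,M_3$ satisfy, for the moduli $q\in[Q,2Q]$ under consideration, $$\frac{x}{\log^{12}x}<M_1M_2M_3\le x,\qquad \frac{x}{q^{\frac32+\alpha}}\le M_3\le M_2\le M_1\le Dq^{1+\alpha}.$$ Write $\mathcal M=(\mathcal M_1,\mathcal M_2,\mathcal M_3)$. Let $f=(f_1,f_2,f_3)$, where exactly one of the $f_i$ is $\chi$ and the other two are identically $1$. For $(a,q)=1$ define $$\mathcal D_{\mathcal M,f}(a,q)=\sum_{\substack{t_1\in\mathcal M_1,\ t_2\in\mathcal M_2,\ t_3\in\mathcal M_3\\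 t_1t_2t_3\equiv a\ (\mathrm{mod}\ q)}}f_1(t_1)f_2(t_2)f_3(t_3),$$ the sum being over integers $t_i$. The term $o(1)$ tends to $0$ as $Q\to\infty$; the implied constant depends only on $\alpha,\kappa,\varepsilon$ (and the constant in the bound for $\Delta$). *)

(* Defs.v *)
From HB Require Import structures.
From mathcomp Require Import all_boot all_order all_algebra.
From mathcomp Require Import finmap.
From mathcomp Require Import all_classical all_reals all_analysis.
Set Implicit Arguments.
Unset Strict Implicit.
Unset Printing Implicit Defensive.
Import Order.TTheory GRing.Theory Num.Theory.
Import numFieldNormedType.Exports.
Local Open Scope classical_set_scope.
Local Open Scope ring_scope.

(* Only quadratic characters are needed, so characters take values in R. *)
Definition dirichlet_character (R : realType) (D : nat) (chi : int -> R) : Prop :=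
  [/\ (0 < D)%N,
      forall m n : int, chi (m * n) = chi m * chi n,
      forall n : int, chi (n + D%:Z) = chi n
    & forall n : int, (chi n != 0) = coprimez n D%:Z].

(* chi has order exactly 2 in the group of characters mod D. *)
Definition quadratic_character (R : realType) (D : nat) (chi : int -> R) : Prop :=
  (forall n : int, coprimez n D%:Z -> chi n ^+ 2 = 1) /\
  (exists2 n : int, coprimez n D%:Z & chi n != 1).

(* chi is not induced from any modulus properly dividing D. *)
Definition primitive_character (R : realType) (D : nat) (chi : int -> R) : Prop :=
  forall d : nat, (d %| D)%N -> (d < D)%N ->
    exists n : int,
      [/\ coprimez n D%:Z, (n = 1 %[mod d%:Z])%Z & chi n != 1].

(* L(s, chi) for real s as the sum of its Dirichlet series, which converges for
   every s > 0 when chi is not principal; [limn] carries no information for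
   s <= 0, hence the condition 0 < beta below. *)
Definition dirichlet_L (R : realType) (chi : int -> R) (s : R) : R :=
  limn (series (fun n : nat => chi n.+1%:Z * n.+1%:R `^ (- s))).

(* For C < 1 the condition 0 < beta is automatic, since the conductor D of a
   quadratic character is at least 3 and ln (2 * 3) > 1. *)
Definition exceptional_character (R : realType) (C : R) (D : nat)
    (chi : int -> R) : Prop :=
  [/\ dirichlet_character D chi,
      quadratic_character D chi,
      primitive_character D chi
    & exists beta : R,
        [/\ 0 < beta, 1 - C / ln (2 * D%:R) <= beta & dirichlet_L chi beta = 0]].

Definition short_interval (R : realType) (M Delta : R) : set int :=
  [set t | M <= t%:~R < M * (1 + Delta)].

Definition exactly_one_is (R : realType) (chi f1 f2 f3 : int -> R) : Prop :=
  [\/ [/\ f1 = chi, f2 = cst 1 & f3 = cst 1],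
      [/\ f1 = cst 1, f2 = chi & f3 = cst 1]
    | [/\ f1 = cst 1, f2 = cst 1 & f3 = chi]].

Definition ternary_sum (R : realType) (M1 M2 M3 Delta : R)
    (f1 f2 f3 : int -> R) (a : int) (q : nat) : R :=
  \sum_(t \in [set t : int * int * int |
          [/\ short_interval M1 Delta t.1.1,
              short_interval M2 Delta t.1.2,
              short_interval M3 Delta t.2
            & (t.1.1 * t.1.2 * t.2 = a %[mod q%:Z])%Z]])
    f1 t.1.1 * f2 t.1.2 * f3 t.2.

Definition max_ternary_sum (R : realType) (M1 M2 M3 Delta : R)
    (f1 f2 f3 : int -> R) (q : nat) : R :=
  \big[Num.max/0]_(a < q | coprime a q)
    `| ternary_sum M1 M2 M3 Delta f1 f2 f3 a%:Z q |.

(* Main.v *)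
Require Import Defs.
From HB Require Import structures.
From mathcomp Require Import all_boot all_order all_algebra.
From mathcomp Require Import finmap.
From mathcomp Require Import all_classical all_reals all_analysis.
From mathcomp Require Import complex.
From mathcomp Require Import zify ring lra.
Set Implicit Arguments.
Unset Strict Implicit.
Unset Printing Implicit Defensive.
Import Order.TTheory GRing.Theory Num.Theory.
Import numFieldNormedType.Exports.
Import ComplexField.Normc.
Local Open Scope classical_set_scope.
Local Open Scope ring_scope.

(** Completing the sum over [t1] turns the congruence [t1 t2 t3 = a] modulo [q]
    into additive characters [e(- h a / (t2 t3 q))]; the character [f1] of period
    [D] is expanded in its own finite Fourier series, so that the frequencies
    are the [D h + q j] modulo [q D].  The zero frequency is an average of [f1]
    times a sum of [chi] over an interval and integers prime to [q], hence has
    size at most [D] times a divisor function; it vanishes when [f1 = chi] and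
    [D] does not divide [q], as [chi] is primitive.  In the other frequencies
    Hoelder's inequality separates [t2] from the pair [(h, t3)]:
      [(sum nu T)^4 <= (sum nu)^2 (sum nu^2) (sum T^4)],
    where the second moment of [nu] is controlled by the divisor bound and the
    fourth moment of [T] is [q] times the number [energy q] of solutions of
    [1 / t1 + 1 / t2 = 1 / t3 + 1 / t4] modulo [q].  The latter is small on
    average over [q], because the cleared numerator has few divisors when it is
    nonzero and vanishes for few quadruples; Markov's inequality then yields
    the exceptional set.  The error exponent [2 alpha] leaves room for all
    divisor-bound losses, so the exceptional set needs no [o(1)]. *)

(** * The divisor bound *)

(** The two terms of the bound are fourth roots. Markov's inequality is run at the threshold Q^(4
    kappa + 4 alpha) (M2^2 + M2^4 / Q) for the energy: M2^2 comes from the quadruples that solve the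
    equation over the integers, M2^4 / Q from a divisor count spread over about Q moduli. The other
    factors of the fourth power are, up to small losses, D^4 M3^3 M1, and M3^3 M1 <= x M2 because M1
    M2 M3 <= x and M3 <= M2. Two consequences of the hypotheses make the losses affordable. The
    lower bound on M3 together with M2 <= x^(1/3) forces Q >= x^(2/5), so a small power of x is paid
    for by a power of Q: of the Q^(8 alpha) available after taking fourth powers, one half absorbs
    divisor and harmonic sums in the Hoelder step, the other half goes into the Markov threshold.
    And D^2 Q < x^(2/3 - 4 alpha) forces M3 >= x^(4 alpha) D, which turns the zero frequency, of
    size about D M1 M2 / Q, into x / Q^(1 + alpha / 2). *)

Lemma size_divisors_pfactor (p e m : nat) : prime p -> (0 < m)%N ->
  (size (divisors (p ^ e * m)) <= e.+1 * size (divisors m))%N.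
Proof.
move=> p_pr m_gt0; have p_gt0 := prime_gt0 p_pr.
rewrite -[e.+1 in leqRHS](size_iota 0).
rewrite -(size_allpairs (fun i d => p ^ i * d)%N).
apply: uniq_leq_size; first exact: divisors_uniq.
move=> d; rewrite -dvdn_divisors ?muln_gt0 ?expn_gt0 ?p_gt0// => dvd_d.
have /(dvdn_pfactor _ _ p_pr)[i le_ie gE] := dvdn_gcdr d (p ^ e).
have g_gt0 : (0 < gcdn d (p ^ e))%N by rewrite gE expn_gt0 p_gt0.
apply/allpairsP; exists (i, (d %/ gcdn d (p ^ e))%N); split.
- by rewrite mem_iota add0n ltnS le_ie.
(* After division by the gcd, the cofactor of [d] is prime to what is left of [p ^ e], so it must
   divide [m]. *)
- rewrite /= -dvdn_divisors//.
  have cop : coprime (d %/ gcdn d (p ^ e)) (p ^ e %/ gcdn d (p ^ e)).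
    rewrite /coprime -(eqn_pmul2r g_gt0) mul1n muln_gcdl.
    by rewrite !divnK ?dvdn_gcdl ?dvdn_gcdr.
  rewrite -(Gauss_dvdr _ cop) -(dvdn_pmul2r g_gt0) divnK ?dvdn_gcdl//.
  by rewrite mulnAC divnK ?dvdn_gcdr.
- by rewrite /= -gE mulnC divnK ?dvdn_gcdl.
Qed.

(** The falling factorial of e + k with k factors lies in between: it is at least (e + 1)^k, and it
    is k factorial times a binomial coefficient from the row of sum 2^(e + k). *)
Lemma expn_S_le_fact_bin (e k : nat) : (e.+1 ^ k <= k`! * 2 ^ (e + k))%N.
Proof.
have le_ffact : (e.+1 ^ k <= (e + k) ^_ k)%N.
  elim: k => [|k IHk]; first by rewrite expn0 ffactn0.
  rewrite expnS addnS ffactSS leq_mul//.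
  by rewrite ltnS leq_addr.
apply: leq_trans le_ffact _.
rewrite -bin_ffact mulnC leq_mul2l; apply/orP; right.
have := Pascal 1 1 (e + k); rewrite addn1 => ->.
have lt_k : (k < (e + k).+1)%N by rewrite ltnS leq_addl.
rewrite (bigD1 (Ordinal lt_k))//= !exp1n !muln1.
exact: leq_addr.
Qed.

(* Primes [p >= 2 ^ k] cost nothing as [(e + 1) ^ k <= 2 ^ (e k) <= p ^ e];
   each smaller prime costs one factor [k`! 2 ^ k]. *)
Lemma size_divisors_exp_le_rough (k b n : nat) : (0 < n)%N ->
    (forall p, prime p -> p %| n -> b <= p)%N ->
  (size (divisors n) ^ k <= (k`! * 2 ^ k) ^ (2 ^ k - b) * n)%N.
Proof.
have C_gt0 : (0 < k`! * 2 ^ k)%N by rewrite muln_gt0 fact_gt0 expn_gt0.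
elim/ltn_ind: n b => n IHn b n_gt0 rough.
have [n_gt1|n_le1] := ltnP 1 n; last first.
  have -> : n = 1%N by case: (n) n_gt0 n_le1 => [|[]].
  by rewrite [divisors 1]/= exp1n muln1 expn_gt0 C_gt0.
set p := pdiv n; have p_pr : prime p by exact: pdiv_prime.
have p_gt1 := prime_gt1 p_pr.
have [m0 cop] := @pfactor_coprime p n p_pr n_gt0.
set e' := logn p n; rewrite mulnC => nE.
have m_gt0 : (0 < m0)%N by move: n_gt0; rewrite nE muln_gt0 => /andP[].
have e_gt0 : (0 < e')%N by rewrite logn_gt0 mem_primes p_pr n_gt0 pdiv_dvd.
have lt_mn : (m0 < n)%N.
  by rewrite nE ltn_Pmull// -{1}(exp1n e') ltn_exp2r.
(* As [p] is the least prime factor, the cofactor is rough above [p]. Moving the bound from [b] to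
   [p.+1] lowers the exponent of the constant by at least one, which pays for [p] when it is below
   2^k. *)
have rough' q : prime q -> (q %| m0)%N -> (p.+1 <= q)%N.
  move=> q_pr q_m; rewrite ltn_neqAle; apply/andP; split.
    apply: contraTneq cop => ->; rewrite coprime_sym.
    by rewrite coprime_sym prime_coprime// negbK.
  by apply: pdiv_min_dvd; rewrite ?prime_gt1// nE dvdn_mull.
have := IHn _ lt_mn p.+1 m_gt0 rough'.
set X := size _; move=> IHm.
apply: (@leq_trans ((e'.+1 * X) ^ k)).
  have [->|k_gt0] := posnP k; first by rewrite !expn0.
  by rewrite leq_exp2r// {1}nE size_divisors_pfactor.
rewrite expnMn [in leqRHS]nE.
have le_bp : (b <= p)%N by apply: rough; rewrite ?pdiv_dvd.
have [le_Bp|lt_pB] := leqP (2 ^ k) p.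
  rewrite mulnCA; apply: leq_mul.
    apply: (@leq_trans ((2 ^ e') ^ k)); last first.
      rewrite -expnM mulnC expnM.
      by have [|? ] := posnP e'; [lia | rewrite leq_exp2r].
    have [->|k_gt0] := posnP k; first by rewrite !expn0.
    by rewrite leq_exp2r// ltn_expl.
  apply: leq_trans IHm _; rewrite leq_mul2r; apply/orP; right.
  by rewrite leq_pexp2l//; lia.
apply: (@leq_trans ((k`! * 2 ^ k * p ^ e') * ((k`! * 2 ^ k) ^ (2 ^ k - p.+1) * m0))).
  apply: leq_mul => //.
  apply: leq_trans (expn_S_le_fact_bin _ _) _.
  rewrite expnD -mulnA leq_mul2l; apply/orP; right.
  by rewrite mulnC leq_mul2l leq_exp2r// p_gt1 orbT.
rewrite mulnACA -expnS mulnA [leqRHS]mulnA leq_mul2r; apply/orP; right.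
rewrite leq_mul2r; apply/orP; right.
by rewrite leq_pexp2l//; lia.
Qed.

Lemma size_divisors_le_powR (R : realType) (d : R) : 0 < d ->
  exists2 C : R, 1 <= C &
    forall n : nat, (0 < n)%N -> (size (divisors n))%:R <= C * n%:R `^ d.
Proof.
move=> d_gt0.
(* Chosen so that 1 / k <= d; the claim is then the k-th root of the preceding lemma at b = 0. *)
pose k := (Num.trunc d^-1).+1.
have kV : k%:R^-1 <= d.
  rewrite -[leRHS]invrK lef_pV2 ?posrE ?invr_gt0 ?ltr0n//.
  by rewrite ltW// truncnS_gt.
set C0 : R := ((k`! * 2 ^ k) ^ (2 ^ k))%:R.
have C0_ge1 : 1 <= C0 by rewrite ler1n expn_gt0 muln_gt0 fact_gt0 expn_gt0.
exists (C0 `^ k%:R^-1) => [|n n_gt0].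
  have kV0 : 0 <= k%:R^-1 :> R by rewrite invr_ge0.
  by have := ler_powR C0_ge1 kV0; rewrite powRr0.
have n_ge1 : 1 <= n%:R :> R by rewrite ler1n.
apply: (@le_trans _ _ (C0 `^ k%:R^-1 * n%:R `^ k%:R^-1)); last first.
  by rewrite ler_wpM2l ?powR_ge0// ler_powR.
rewrite -powRM ?ler0n//.
have -> : (size (divisors n))%:R = ((size (divisors n))%:R ^+ k : R) `^ k%:R^-1.
  by rewrite -powR_mulrn// -powRrM divff ?powRr1// pnatr_eq0.
apply: ge0_ler_powR; rewrite ?invr_ge0 ?nnegrE ?exprn_ge0 ?mulr_ge0//.
rewrite -natrX -natrM ler_nat.
have := @size_divisors_exp_le_rough k 0 n n_gt0 (fun _ _ _ => leq0n _).
by rewrite subn0.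
Qed.

(** * Additive characters *)

(** By the mean value theorem sin y = y cos z with z below y, and cosine decreases. *)
Lemma sin_ge_mulcos (R : realType) (y : R) : 0 <= y <= pi / 2 ->
  y * cos y <= sin y.
Proof.
move=> /andP[y_ge0 y_le].
have [->|y_neq0] := eqVneq y 0; first by rewrite mul0r sin0.
have y_gt0 : 0 < y by rewrite lt_neqAle eq_sym y_neq0.
have [z zy] := @MVT R sin cos 0 y y_gt0 (fun x _ => is_derive_sin x)
  (continuous_subspaceT (@continuous_sin R)).
rewrite sin0 !subr0 => ->; rewrite mulrC ler_wpM2r//.
move: zy; rewrite in_itv/= => /andP[z0 zy].
have pi0 := pi_gt0 R.
by apply: ltW; rewrite ltr_cos ?in_itv/=; lra.
Qed.

(** A weak form of Jordan's inequality: sin y = 2 sin (y / 2) cos (y / 2) >= y cos^2 (y / 2) = y (1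
    + cos y) / 2. *)
Lemma sin_ge_half (R : realType) (y : R) : 0 <= y <= pi / 2 -> y / 2 <= sin y.
Proof.
move=> /andP[y_ge0 y_le]; have pi0 := pi_gt0 R.
have yE : y = (y / 2) *+ 2 by rewrite mulr2n; lra.
rewrite {2}yE sin_mulr2n.
have h1 := @sin_ge_mulcos R (y / 2).
have c0 : 0 <= cos (y / 2) by apply: cos_ge0_pihalf; lra.
have cy : 0 <= cos y by apply: cos_ge0_pihalf; lra.
move: cy; rewrite {1}yE cos_mulr2n mulr2n => cy.
have {}h1 : y / 2 * cos (y / 2) <= sin (y / 2) by apply: h1; lra.
have h2 : cos (y / 2) * (y / 2 * cos (y / 2)) <= cos (y / 2) * sin (y / 2).
  by rewrite ler_wpM2l.
have := mulr_ge0 y_ge0 cy.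
set C := cos _ in h2 *; set S := sin _ in h2 *.
by rewrite -[(C * S) *+ 2]mulr_natl; lra.
Qed.

(** The additive character e(n / N), where e(z) = exp(2 pi i z). Division by zero gives 0, so it is
    constantly 1 for N = 0. *)
Definition ek (R : realType) (N : nat) (n : int) : R[i] :=
  (cos (2 * pi * (n%:~R / N%:R)) +i* sin (2 * pi * (n%:~R / N%:R)))%C.

Lemma normc_cossin (R : realType) (x : R) : normc (cos x +i* sin x)%C = 1.
Proof. by rewrite /normc cos2Dsin2 sqrtr1. Qed.

Lemma normc_ek (R : realType) N n : normc (ek R N n) = 1.
Proof. exact: normc_cossin. Qed.

Lemma ekD (R : realType) N m n : ek R N (m + n) = ek R N m * ek R N n.
Proof.
have E : 2 * pi * ((m + n)%:~R / N%:R) =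
    2 * pi * (m%:~R / N%:R) + 2 * pi * (n%:~R / N%:R) :> R.
  by rewrite intrD; ring.
rewrite /ek E cosD sinD.
apply/eqP; rewrite eq_complex /= eqxx /=.
by apply/eqP; rewrite [RHS]addrC.
Qed.

Lemma ek0 (R : realType) N : ek R N 0 = 1.
Proof. by rewrite /ek mul0r mulr0 cos0 sin0. Qed.

Lemma ekN (R : realType) N n : ek R N (- n) = (ek R N n)^*%C.
Proof. by rewrite /ek rmorphN /= mulNr mulrN cosN sinN. Qed.

Lemma ekX (R : realType) N n (k : nat) : ek R N (k%:Z * n) = ek R N n ^+ k.
Proof.
elim: k => [|k IHk]; first by rewrite mul0r ek0.
by rewrite -addn1 PoszD mulrDl ekD IHk mul1r addn1 exprSr.
Qed.

Lemma ek_self (R : realType) N : ek R N N%:Z = 1.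
Proof.
rewrite /ek; have [->|N_gt0] := posnP N.
  by rewrite invr0 !mulr0 cos0 sin0.
by rewrite pmulrn divff ?pnatr_eq0 -?lt0n// mulr1 mulr_natl cos2pi sin2pi.
Qed.

Lemma ek_dvd (R : realType) N n : (N%:Z %| n)%Z -> ek R N n = 1.
Proof.
move=> /dvdzP[k ->]; case: k => k; first by rewrite ekX ek_self expr1n.
rewrite NegzE mulNr ekN ekX ek_self expr1n.
by apply/eqP; rewrite eq_complex /= oppr0 !eqxx.
Qed.

Lemma ek_eqmod (R : realType) (N : nat) (m n : int) :
  (N%:Z %| m - n)%Z -> ek R N m = ek R N n.
Proof. by move=> dvd; rewrite -[m](subrK n) ekD ek_dvd ?mul1r. Qed.

Lemma ek_scale (R : realType) (N D : nat) (n : int) : (0 < D)%N ->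
  ek R (N * D) (n * D%:Z) = ek R N n.
Proof.
move=> D_gt0; rewrite /ek.
have -> : (n * D%:Z)%:~R / (N * D)%:R = n%:~R / N%:R :> R.
  rewrite intrM natrM invfM mulrACA -pmulrn divff ?mulr1//.
  by rewrite pnatr_eq0 -lt0n.
by [].
Qed.

(** The modulus is 2 |sin (pi r / N)|, and [sin_ge_half] applies to r / N or, by the symmetry of
    sine about pi / 2, to 1 - r / N. The left side is the distance from r / N to the nearest
    integer. *)
Lemma normc_sub1_ek (R : realType) (N r : nat) : (r <= N)%N -> (0 < N)%N ->
  (minn r (N - r))%:R / N%:R <= normc (1 - ek R N r%:Z).
Proof.
move=> le_rN N_gt0; set t : R := r%:R / N%:R.
have N0 : 0 < N%:R :> R by rewrite ltr0n.
have t01 : 0 <= t <= 1.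
  by rewrite divr_ge0//= ler_pdivrMr// mul1r ler_nat.
have pi2 := pi_ge2 R.
have normE : normc (1 - ek R N r%:Z) = 2 * `|sin (pi * t)|.
  rewrite /ek /normc /= -pmulrn -/t.
  have -> : 2 * pi * t = (pi * t) *+ 2 :> R by rewrite mulr2n; ring.
  rewrite cos_mulr2n sin_mulr2n.
  have -> : (1 - (cos (pi * t) ^+ 2 *+ 2 - 1)) ^+ 2 +
      (0 - (cos (pi * t) * sin (pi * t)) *+ 2) ^+ 2 =
      (2 * sin (pi * t)) ^+ 2 :> R.
    have := cos2Dsin2 (pi * t); rewrite !mulr2n => h.
    have -> : cos (pi * t) ^+ 2 = 1 - sin (pi * t) ^+ 2 by rewrite -h; ring.
    have -> : (0 - (cos (pi * t) * sin (pi * t) + cos (pi * t) * sin (pi * t))) ^+ 2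
       = 4 * (cos (pi * t) ^+ 2 * sin (pi * t) ^+ 2) by ring.
    have -> : cos (pi * t) ^+ 2 = 1 - sin (pi * t) ^+ 2 by rewrite -h; ring.
    by ring.
  by rewrite sqrtr_sqr normrM ger0_norm.
have [minE|minE] : (minn r (N - r))%:R / N%:R <= t /\ (t <= 1/2) \/
    (minn r (N - r))%:R / N%:R <= 1 - t /\ (1/2 <= t).
  have tN : t * N%:R = r%:R by rewrite divfK// gt_eqF.
  have [le|le] := leqP r (N - r).
    left; split=> //.
    rewrite ler_pdivrMr// .
    have : (r + r <= N)%N by lia.
    by rewrite -(ler_nat R) natrD => ?; lra.
  right; rewrite natrB//; split.
    rewrite mulrBl divff ?gt_eqF//.
  have : (N <= r + r)%N by lia.
  by rewrite -(ler_nat R) natrD => ?; rewrite ler_pdivlMr//; lra.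
- rewrite normE; apply: le_trans minE.1 _.
  have h : pi * t / 2 <= sin (pi * t) by apply: sin_ge_half; nra.
  rewrite ger0_norm; last by nra.
  by nra.
- rewrite normE; apply: le_trans minE.1 _.
  have -> : sin (pi * t) = sin (pi * (1 - t)).
    rewrite mulrBr mulr1 sinB sinpi cospi; ring.
  have h : pi * (1 - t) / 2 <= sin (pi * (1 - t)) by apply: sin_ge_half; nra.
  rewrite ger0_norm; last by nra.
  by nra.
Qed.

Lemma ler_normc_sum (R : realType) (I : Type) (r : seq I) (P : pred I)
    (F : I -> R[i]) :
  normc (\sum_(i <- r | P i) F i) <= \sum_(i <- r | P i) normc (F i).
Proof.
elim/big_ind2: _ => [|x1 x2 y1 y2 h1 h2|//]; first by rewrite normc0.
by apply: le_trans (le_normcD _ _) _; exact: lerD.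
Qed.

Lemma normc_ge0 (R : realType) (z : R[i]) : 0 <= normc z.
Proof. by case: z => a b; exact: sqrtr_ge0. Qed.

Lemma normc_real (R : realType) (x : R) : normc (x%:C)%C = `|x|.
Proof. by rewrite /normc /= expr0n addr0 sqrtr_sqr. Qed.

Lemma sum_ek_mul (R : realType) (N A B : nat) (n : int) : (A <= B)%N ->
  (1 - ek R N n) * (\sum_(A <= t < B) ek R N (t%:Z * n)) =
  ek R N (A%:Z * n) - ek R N (B%:Z * n).
Proof.
move=> le_AB; rewrite big_distrr/= -[RHS]opprB.
rewrite -(telescope_sumr (fun t => ek R N (t%:Z * n)) le_AB) -sumrN.
apply: eq_bigr => t _.
have -> : t.+1%:Z * n = t%:Z * n + n by lia.
rewrite ekD; ring.
Qed.

(** The telescoped geometric sum has numerator at most 2; its denominator depends only on the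
    residue [r] of [n]. *)
Lemma normc_sum_ek (R : realType) (N A B r : nat) (n : int) :
    (A <= B)%N -> (0 < N)%N -> (r < N)%N -> (N%:Z %| n - r%:Z)%Z ->
    (0 < r)%N ->
  normc (\sum_(A <= t < B) ek R N (t%:Z * n)) <=
    2 * N%:R / (minn r (N - r))%:R.
Proof.
move=> le_AB N_gt0 lt_rN dvd r_gt0.
set m := minn _ _; have m_gt0 : 0 < m%:R :> R by rewrite ltr0n; lia.
have N0 : 0 < N%:R :> R by rewrite ltr0n.
rewrite ler_pdivlMr// mulrC -ler_pdivrMr// mulrAC.
apply: (@le_trans _ _ (normc (1 - ek R N n) *
    normc (\sum_(A <= t < B) ek R N (t%:Z * n)))).
  rewrite ler_wpM2r ?normc_ge0// (ek_eqmod _ dvd).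
  exact: (normc_sub1_ek _ (ltnW lt_rN) N_gt0).
rewrite -normcM sum_ek_mul//; apply: le_trans (le_normcD _ _) _.
by rewrite normcN !normc_ek.
Qed.

Lemma ek_orth (R : realType) (N : nat) (n : int) : (0 < N)%N ->
  \sum_(0 <= h < N) ek R N (h%:Z * n) =
    if (N%:Z %| n)%Z then N%:R else 0.
Proof.
move=> N_gt0; case: ifPn => [dvd|ndvd].
  rewrite (eq_bigr (fun=> 1)) => [|h _]; last by rewrite ek_dvd// dvdz_mull.
  by rewrite big_const_nat subn0 iter_addr_0.
have := @sum_ek_mul R N 0 N n (leq0n _).
rewrite mul0r ek0 (@ek_dvd _ _ (N%:Z * n)) ?dvdz_mulr// subrr => /eqP.
rewrite mulf_eq0 => /orP[/eqP h|/eqP//].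
(* If e(n / N) were 1, the nonzero residue [r] of [n] would contradict the lower bound for |1 - e(r
   / N)|. *)
pose r := `|(n %% N%:Z)%Z|%N.
have rE : (r%:Z = (n %% N%:Z)%Z).
  by rewrite gez0_abs// modz_ge0// -lt0n.
have lt_rN : (r < N)%N by rewrite -ltz_nat rE ltz_pmod.
have r_gt0 : (0 < r)%N.
  by rewrite lt0n; apply: contra ndvd; rewrite -eqz_nat rE => /eqP/dvdz_mod0P.
have dvd : (N%:Z %| n - r%:Z)%Z.
  by rewrite rE {1}(divz_eq n N%:Z) addrK dvdz_mull.
have := @normc_sub1_ek R N r (ltnW lt_rN) N_gt0.
rewrite -(ek_eqmod _ dvd) h normc0 leNgt => /negP[].
by rewrite divr_gt0// ltr0n; lia.
Qed.

(** * Hoelder's inequality and sums over progressions *)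

Lemma ler_sum_sub_uniq (R : realType) (I : eqType) (r s : seq I) (g : I -> R) :
    uniq r -> uniq s -> {subset r <= s} -> (forall i, 0 <= g i) ->
  \sum_(i <- r) g i <= \sum_(i <- s) g i.
Proof.
move=> r_uniq s_uniq rs g_ge0.
have rE : perm_eq r [seq i <- s | i \in r].
  apply: uniq_perm; rewrite ?filter_uniq// => i; rewrite mem_filter.
  by apply/idP/andP => [ir|[]//]; rewrite ir rs.
rewrite (perm_big _ rE) big_filter big_mkcond/=; apply: ler_sum => i _.
by case: ifP.
Qed.

Lemma ler_sum_inj (R : realType) (I J : eqType) (r : seq I) (s : seq J)
    (P : pred I) (f : I -> J) (g : J -> R) :
    uniq r -> uniq s -> {in [seq i <- r | P i] &, injective f} ->
    {in r, forall i, P i -> f i \in s} -> (forall j, 0 <= g j) ->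
  \sum_(i <- r | P i) g (f i) <= \sum_(j <- s) g j.
Proof.
move=> r_uniq s_uniq f_inj f_s g_ge0.
rewrite -big_filter -(big_map f predT g).
apply: ler_sum_sub_uniq => //.
  by rewrite map_inj_in_uniq ?filter_uniq.
by move=> _ /mapP[i + ->]; rewrite mem_filter => /andP[Pi ir]; exact: f_s.
Qed.

(** Lagrange's identity: twice the difference of the two sides is the double sum of w_i w_k (T_i -
    T_k)^2. *)
Lemma weighted_cauchy (R : realType) (I : Type) (r : seq I) (P : pred I)
    (w T : I -> R) : (forall i, 0 <= w i) ->
  (\sum_(i <- r | P i) w i * T i) ^+ 2 <=
  (\sum_(i <- r | P i) w i) * (\sum_(i <- r | P i) w i * T i ^+ 2).
Proof.
move=> w_ge0.
rewrite -subr_ge0; set S1 := \sum_(i <- r | P i) w i.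
set S2 := \sum_(i <- r | P i) w i * T i ^+ 2.
set S3 := \sum_(i <- r | P i) w i * T i.
have : 0 <= \sum_(i <- r | P i) \sum_(k <- r | P k) w i * w k * (T i - T k) ^+ 2.
  do 2! [apply: sumr_ge0 => ? _].
  by apply: mulr_ge0; [exact: mulr_ge0 | exact: sqr_ge0].
have -> : \sum_(i <- r | P i) \sum_(k <- r | P k) w i * w k * (T i - T k) ^+ 2 =
    2 * (S1 * S2 - S3 ^+ 2).
  transitivity (\sum_(i <- r | P i) (w i * T i ^+ 2 * S1 - 2 * (w i * T i) * S3 + w i * S2)).
    apply: eq_bigr => i _; rewrite !big_distrr/= -sumrN -!big_split/=.
    by apply: eq_bigr => k _; ring.
  rewrite !big_split/= sumrN -!mulr_suml -mulr_sumr -/S1 -/S2 -/S3; ring.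
by rewrite pmulr_rge0.
Qed.

Lemma cauchy_sum (R : realType) (I : Type) (r : seq I) (x y : I -> R) :
  (\sum_(i <- r) x i * y i) ^+ 2 <=
  (\sum_(i <- r) x i ^+ 2) * (\sum_(i <- r) y i ^+ 2).
Proof.
rewrite -subr_ge0; set S1 := \sum_(i <- r) x i ^+ 2.
set S2 := \sum_(i <- r) y i ^+ 2; set S3 := \sum_(i <- r) x i * y i.
have : 0 <= \sum_(i <- r) \sum_(k <- r) (x i * y k - x k * y i) ^+ 2.
  by do 2! [apply: sumr_ge0 => ? _]; exact: sqr_ge0.
have -> : \sum_(i <- r) \sum_(k <- r) (x i * y k - x k * y i) ^+ 2 =
    2 * (S1 * S2 - S3 ^+ 2).
  transitivity (\sum_(i <- r) (x i ^+ 2 * S2 - 2 * (x i * y i) * S3 + y i ^+ 2 * S1)).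
    apply: eq_bigr => i _; rewrite !big_distrr/= -sumrN -!big_split/=.
    by apply: eq_bigr => k _; ring.
  rewrite !big_split/= sumrN -!mulr_suml -mulr_sumr -/S1 -/S2 -/S3; ring.
by rewrite pmulr_rge0.
Qed.

(** With [nu v] the total weight of the fibre of [u] over [v], the middle factor is the sum of nu^2,
    written over pairs in a common fibre so that it can be bounded by counting collisions. The
    inequality is Cauchy-Schwarz twice, first with weights [nu] and then between [nu] and T^2. *)
Lemma holder_fibre (R : realType) (I : Type) (r : seq I) (P : pred I) (q : nat)
    (w : I -> R) (u : I -> nat) (T : nat -> R) :
    (forall i, 0 <= w i) -> (forall i, (u i < q)%N) ->
  (\sum_(i <- r | P i) w i * T (u i)) ^+ 4 <=
  (\sum_(i <- r | P i) w i) ^+ 2 *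
  (\sum_(i <- r | P i) w i * \sum_(k <- r | P k && (u k == u i)) w k) *
  (\sum_(0 <= v < q) T v ^+ 4).
Proof.
move=> w_ge0 u_lt.
pose nu v := \sum_(k <- r | P k && (u k == v)) w k.
have nuE (F : nat -> R) :
    \sum_(i <- r | P i) w i * F (u i) = \sum_(0 <= v < q) nu v * F v.
  transitivity (\sum_(i <- r | P i) \sum_(0 <= v < q) (if u i == v then w i * F v else 0)).
    apply: eq_bigr => i _; rewrite -big_mkcond/=.
    rewrite (big_rem (u i)) ?mem_index_iota//= eqxx.
    rewrite big_seq_cond big1 ?addr0// => v /andP[+ /eqP uv].
    by rewrite -uv mem_rem_uniqF ?iota_uniq.
  rewrite exchange_big/=; apply: eq_bigr => v _.
  by rewrite -big_mkcondr/= mulr_suml.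
rewrite nuE (_ : 4 = 2 * 2)%N// exprM.
have sqr_le (x y : R) : 0 <= x -> x <= y -> x ^+ 2 <= y ^+ 2.
  by move=> x0 xy; rewrite lerXn2r// ?nnegrE// (le_trans x0).
apply: le_trans (sqr_le _ _ (sqr_ge0 _) (weighted_cauchy _ _ _ _)) _.
  by move=> v; apply: sumr_ge0.
rewrite exprMn.
have -> : \sum_(0 <= v < q) nu v = \sum_(i <- r | P i) w i.
  have := nuE (fun=> 1); under eq_bigr do rewrite mulr1.
  by move=> ->; apply: eq_bigr => v _; rewrite mulr1.
rewrite -mulrA; apply: ler_wpM2l; first exact: sqr_ge0.
apply: le_trans (cauchy_sum _ _ _) _.
rewrite le_eqVlt; apply/orP; left; apply/eqP; congr (_ * _).
  rewrite -[RHS]/(\sum_(i <- r | P i) w i * nu (u i)) nuE.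
  by apply: eq_bigr => v _; rewrite expr2.
by apply: eq_bigr => v _; rewrite -exprM.
Qed.

(** Collect the pairs by their product m = v t: the factor [t] is a divisor of [m] and determines
    [v]. *)
Lemma sum_mul_le_divisors (R : realType) (r : seq nat) (X V : nat)
    (g : nat -> R) : uniq r -> {in r, forall t, (0 < t)%N} ->
    {in r, forall t, (V * t <= X)%N} -> (forall m, 0 <= g m) ->
  \sum_(t <- r) \sum_(1 <= v < V.+1) g (v * t)%N <=
  \sum_(1 <= m < X.+1) (size (divisors m))%:R * g m.
Proof.
move=> r_uniq r_gt0 r_X g_ge0.
apply: (@le_trans _ _ (\sum_(t <- r) \sum_(1 <= m < X.+1 | (t %| m)%N) g m)).
  rewrite [leLHS]big_seq_cond [leRHS]big_seq_cond.
  apply: ler_sum => t /andP[tr _].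
  rewrite -[leRHS]big_filter -(big_map (fun v => v * t)%N predT g).
  apply: ler_sum_sub_uniq; rewrite ?filter_uniq ?iota_uniq//.
    rewrite map_inj_uniq ?iota_uniq// => v v' /eqP.
    by rewrite eqn_pmul2r ?r_gt0// => /eqP.
  move=> _ /mapP[v + ->]; rewrite mem_filter !mem_index_iota dvdn_mull//=.
  move=> /andP[v1 vV]; rewrite muln_gt0 v1 r_gt0//= ltnS.
  by apply: leq_trans (r_X _ tr); rewrite leq_mul2r -ltnS vV orbT.
under eq_bigr do rewrite big_mkcond/=.
rewrite exchange_big/= big_seq_cond [leRHS]big_seq_cond.
apply: ler_sum => m /andP[+ _]; rewrite mem_index_iota => /andP[m_gt0 _].
rewrite -big_mkcond/= big_const_seq iter_addr_0 -[leLHS]mulr_natl.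
rewrite ler_wpM2r// ler_nat -size_filter; apply: uniq_leq_size.
  by rewrite filter_uniq.
by move=> t; rewrite mem_filter -dvdn_divisors// => /andP[].
Qed.

Definition harm (R : realType) (X : nat) : R := \sum_(1 <= k < X.+1) k%:R^-1.

Lemma harm_ge0 (R : realType) X : 0 <= harm R X.
Proof. by apply: sumr_ge0 => k _; rewrite invr_ge0. Qed.

Lemma le_harm (R : realType) X Y : (X <= Y)%N -> harm R X <= harm R Y.
Proof.
move=> XY; apply: ler_sum_sub_uniq; rewrite ?iota_uniq//.
by move=> k; rewrite !mem_index_iota => /andP[-> /leq_trans->].
Qed.

(** Each block of [q] consecutive integers contains at most one term of the progression. In block k
    >= 1 that term exceeds q k, so B / m <= B / (q k); the first block is covered by [A]. *)
Lemma sum_progression_le (R : realType) (q n X : nat) (A B : R)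
    (g : nat -> R) : (0 < q)%N -> 0 <= A -> 0 <= B ->
    (forall m, (0 < m)%N -> g m <= A) -> (forall m, (0 < m)%N -> g m <= B / m%:R) ->
  \sum_(1 <= m < X.+1 | (q %| m + n)%N) g m <= A + B / q%:R * harm R X.
Proof.
move=> q_gt0 A_ge0 B_ge0 gA gB.
(* Blocks are indexed by (m - 1) / q, so block k runs from q k + 1 to q (k + 1). *)
pose G k : R := if k is k'.+1 then B / q%:R * k%:R^-1 else A.
apply: (@le_trans _ _ (\sum_(1 <= m < X.+1 | (q %| m + n)%N) G ((m.-1) %/ q)%N)).
  rewrite big_seq_cond [leRHS]big_seq_cond; apply: ler_sum => m.
  rewrite mem_index_iota => /andP[/andP[m_gt0 _] _].
  rewrite /G; case E: (_ %/ _)%N => [|k]; first exact: gA.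
  apply: le_trans (gB _ m_gt0) _; rewrite -mulrA ler_wpM2l// -invfM -natrM.
  have le_m : (q * k.+1 <= m)%N.
    by have := leq_trunc_div m.-1 q; rewrite E; lia.
  by rewrite lef_pV2 ?posrE ?ltr0n ?ler_nat//; lia.
have -> : A + B / q%:R * harm R X = \sum_(0 <= k < X.+1) G k.
  rewrite big_ltn//; congr (_ + _); rewrite mulr_sumr !big_nat.
  by apply: eq_bigr => -[].
apply: ler_sum_inj; rewrite ?iota_uniq//.
- move=> m m'; rewrite !mem_filter !mem_index_iota.
  move=> /andP[dvd /andP[m_gt0 _]] /andP[dvd' /andP[m_gt0' _]] E.
  have : m = m' %[mod q].
    by apply/eqP; rewrite -(eqn_modDr n) (eqP dvd) (eqP dvd').
  move=> Em; rewrite -(prednK m_gt0) -(prednK m_gt0').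
  rewrite (divn_eq m.-1 q) (divn_eq m'.-1 q) E; congr (_ + _).+1%N.
  apply/eqP; rewrite -(eqn_modDr 1) !addn1 !prednK//; exact/eqP.
- move=> m; rewrite !mem_index_iota => /andP[_ mX] _; rewrite leq0n /=.
  by apply: leq_ltn_trans (leq_div _ _) _; lia.
- by case=> [//|k]; rewrite /G mulr_ge0 ?divr_ge0.
Qed.

(** * Completion and the fourth moment *)

Definition modinv (q t : nat) : nat := (egcdn t q).1.

Lemma modinvP (q t : nat) : coprime t q -> (q%:Z %| (t * modinv q t)%:Z - 1)%Z.
Proof.
rewrite /modinv; have [->|t_gt0] := posnP t.
  by rewrite /coprime gcd0n => /eqP->; rewrite dvd1z.
case: egcdnP => // u v E _ /eqP cop /=.
have -> : (t * u)%:Z - 1 = v%:Z * q%:Z by move: E; rewrite cop; lia.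
exact: dvdz_mull.
Qed.

Lemma ternary_cong_modinv (q a t1 t2 t3 : nat) : coprime t2 q -> coprime t3 q ->
  (q%:Z %| (t1 * t2 * t3)%:Z - a%:Z)%Z =
  (q%:Z %| t1%:Z - (a * modinv q t2 * modinv q t3)%:Z)%Z.
Proof.
move=> c2 c3; have d2 := modinvP c2; have d3 := modinvP c3.
set i2 := modinv q t2 in d2 *; set i3 := modinv q t3 in d3 *.
apply/idP/idP => h.
- have -> : t1%:Z - (a * i2 * i3)%:Z =
      ((t1 * t2 * t3)%:Z - a%:Z) * (i2 * i3)%:Z
      - t1%:Z * (t3 * i3)%:Z * ((t2 * i2)%:Z - 1)
      - t1%:Z * ((t3 * i3)%:Z - 1) by rewrite !PoszM; ring.
  by rewrite 2?rpredB ?(dvdz_mulr _ h) ?(dvdz_mull _ d2) ?(dvdz_mull _ d3).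
- have -> : (t1 * t2 * t3)%:Z - a%:Z =
      (t1%:Z - (a * i2 * i3)%:Z) * (t2 * t3)%:Z
      + a%:Z * (t3 * i3)%:Z * ((t2 * i2)%:Z - 1)
      + a%:Z * ((t3 * i3)%:Z - 1) by rewrite !PoszM; ring.
  by rewrite 2?rpredD ?(dvdz_mulr _ h) ?(dvdz_mull _ d2) ?(dvdz_mull _ d3).
Qed.

(** With the factor 1 / D here, the coefficients of a function bounded by 1 are bounded by 1 and the
    inversion formula carries no factor; summing over [j] later costs a factor [D]. *)
Definition fcoef (R : realType) (D : nat) (f : nat -> R) (j : nat) : R[i] :=
  D%:R^-1 * \sum_(0 <= y < D) (f y)%:C%C * ek R D (- (j * y)%:Z).

Lemma normc_natV (R : realType) (n : nat) : normc (n%:R^-1 : R[i]) = n%:R^-1.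
Proof.
by rewrite -(rmorph_nat (real_complex R)) -fmorphV normc_real ger0_norm ?invr_ge0.
Qed.

Lemma normc_fcoef (R : realType) (D : nat) (f : nat -> R) (j : nat) :
  (0 < D)%N -> (forall n, `|f n| <= 1) -> normc (fcoef D f j) <= 1.
Proof.
move=> D_gt0 f_le1; rewrite normcM normc_natV ler_pdivrMl ?ltr0n// mulr1.
apply: le_trans (ler_normc_sum _ _ _) _.
apply: (@le_trans _ _ (\sum_(0 <= y < D) 1)).
  by apply: ler_sum => y _; rewrite normcM normc_real normc_ek mulr1.
by rewrite big_const_nat subn0 iter_addr_0.
Qed.

Lemma fcoef_inversion (R : realType) (D : nat) (f : nat -> R) (t : nat) :
  (0 < D)%N -> (forall n, f (n + D)%N = f n) ->
  (f t)%:C%C = \sum_(0 <= j < D) fcoef D f j * ek R D (j * t)%:Z.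
Proof.
move=> D_gt0 f_per.
have fmod n : f n = f (n %% D)%N.
  rewrite {1}(divn_eq n D); elim: (n %/ D)%N => [|k IHk]; first by rewrite add0n.
  by rewrite -IHk -[RHS]f_per mulSn; congr f; lia.
have D0 : D%:R != 0 :> R[i] by rewrite pnatr_eq0 -lt0n.
transitivity (D%:R^-1 * \sum_(0 <= y < D) (f y)%:C%C *
    \sum_(0 <= j < D) ek R D (j%:Z * (t%:Z - y%:Z))); last first.
  under [RHS]eq_bigr do rewrite /fcoef -mulrA mulr_suml.
  rewrite -mulr_sumr exchange_big/=; congr (_ * _).
  apply: eq_bigr => y _; rewrite mulr_sumr; apply: eq_bigr => j _.
  by rewrite -mulrA -ekD; congr (_ * ek _ _ _); lia.
rewrite (big_rem (t %% D)%N) ?mem_index_iota ?ltn_mod//= ek_orth// ifT; last first.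
  by rewrite {1}(divn_eq t D) PoszD addrK PoszM dvdz_mull.
rewrite big_seq big1 ?addr0 => [|y].
  by rewrite mulrCA mulVf// mulr1 -fmod.
rewrite mem_rem_uniq ?iota_uniq// inE mem_index_iota => /andP[yt /andP[_ yD]].
rewrite ek_orth// ifF ?mulr0//; apply/negP => dvd.
case/negP: yt; rewrite eq_sym -(modn_small yD).
by rewrite -eqz_nat -!modz_nat eqz_mod_dvd.
Qed.

(** The sum of e(t (h / q + j / D)), with the two fractions brought to the common denominator q
    D. *)
Definition geomsum (R : realType) (A B q D j h : nat) : R[i] :=
  \sum_(A <= t < B) ek R (q * D) (t%:Z * (D * h + q * j)%:Z).

Lemma sum_progression_fourier (R : realType) (A B q D b : nat) (f : nat -> R) :
    (0 < q)%N -> (0 < D)%N -> (forall n, f (n + D)%N = f n) ->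
  (\sum_(A <= t < B | (q%:Z %| t%:Z - b%:Z)%Z) f t)%:C%C =
  \sum_(0 <= j < D) \sum_(0 <= h < q)
     fcoef D f j * (q%:R^-1 * geomsum R A B q D j h) * ek R q (- (h * b)%:Z).
Proof.
move=> q_gt0 D_gt0 f_per.
have q0 : q%:R != 0 :> R[i] by rewrite pnatr_eq0 -lt0n.
rewrite big_mkcond/= rmorph_sum/=.
transitivity (\sum_(A <= t < B) \sum_(0 <= j < D) \sum_(0 <= h < q)
   fcoef D f j * (q%:R^-1 * ek R (q * D) (t%:Z * (D * h + q * j)%:Z)) *
   ek R q (- (h * b)%:Z)).
  apply: eq_bigr => t _.
  transitivity (\sum_(0 <= j < D) fcoef D f j * ek R D (j * t)%:Z *
     (q%:R^-1 * \sum_(0 <= h < q) ek R q (h%:Z * (t%:Z - b%:Z)))).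
    rewrite -mulr_suml -fcoef_inversion// ek_orth//.
    by case: ifP => _; rewrite ?mulVf ?mulr1 ?mulr0.
  apply: eq_bigr => j _; rewrite !mulr_sumr; apply: eq_bigr => h _.
  have -> : ek R (q * D) (t%:Z * (D * h + q * j)%:Z) =
      ek R q (h * t)%:Z * ek R D (j * t)%:Z.
    rewrite -(ek_scale R q (h * t)%:Z D_gt0).
    rewrite -(ek_scale R D (j * t)%:Z q_gt0) mulnC -ekD.
    by congr (ek _ _ _); lia.
  have -> : h%:Z * (t%:Z - b%:Z) = (h * t)%:Z + - (h * b)%:Z by lia.
  by rewrite ekD; ring.
rewrite exchange_big/=; apply: eq_bigr => j _.
rewrite exchange_big/=; apply: eq_bigr => h _.
by rewrite /geomsum -mulr_suml -mulr_sumr -mulr_sumr.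
Qed.

(* [1 / t1 + 1 / t2 = 1 / t3 + 1 / t4] modulo [q], with denominators cleared. *)
Definition inv_cong (q t1 t2 t3 t4 : nat) : bool :=
  (q%:Z %| ((t1 + t2) * t3 * t4)%:Z - ((t3 + t4) * t1 * t2)%:Z)%Z.

(** The additive energy of the inverses modulo [q]. With cleared denominators it makes sense for a
    list that does not depend on [q], so the sum over moduli can be moved inside. *)
Definition energy (q : nat) (r : seq nat) : nat :=
  \sum_(t1 <- r) \sum_(t2 <- r) \sum_(t3 <- r) \sum_(t4 <- r)
    inv_cong q t1 t2 t3 t4.

(** This is [T] of the overview; in the application [u] is h / t3 modulo [q]. *)
Definition expsum (R : realType) (q a : nat) (r : seq nat) (f : nat -> R)
    (u : nat) : R :=
  normc (\sum_(t <- r) (f t)%:C%C * ek R q (- (u * a * modinv q t)%:Z)).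

Lemma expsum_mod (R : realType) (q a : nat) (r : seq nat) (f : nat -> R) u :
  expsum q a r f (u %% q)%N = expsum q a r f u.
Proof.
congr normc; apply: eq_bigr => t _; congr (_ * _); apply: ek_eqmod.
have -> : - (u %% q * a * modinv q t)%:Z - - (u * a * modinv q t)%:Z =
    (u %/ q * a * modinv q t)%:Z * q%:Z.
  by rewrite {2}(divn_eq u q) !PoszM PoszD PoszM; ring.
exact: dvdz_mull.
Qed.

(** Multiply the relation between the inverses by t1 t2 t3 t4 and cancel the unit [a]. *)
Lemma energy_inverses (q a t1 t2 t3 t4 : nat) : coprime a q ->
    coprime t1 q -> coprime t2 q -> coprime t3 q -> coprime t4 q ->
    (q%:Z %| (a * modinv q t3)%:Z + (a * modinv q t4)%:Z
             - (a * modinv q t1)%:Z - (a * modinv q t2)%:Z)%Z ->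
  inv_cong q t1 t2 t3 t4.
Proof.
rewrite /inv_cong => ca c1 c2 c3 c4.
have := modinvP c1; have := modinvP c2; have := modinvP c3; have := modinvP c4.
set i1 := modinv q t1; set i2 := modinv q t2; set i3 := modinv q t3.
set i4 := modinv q t4 => d4 d3 d2 d1 h.
have ca' : coprimez q%:Z a%:Z by rewrite coprimezE coprime_sym.
rewrite -(Gauss_dvdzr _ ca').
have -> : a%:Z * (((t1 + t2) * t3 * t4)%:Z - ((t3 + t4) * t1 * t2)%:Z) =
   (a * t1 * t2 * t4)%:Z * ((t3 * i3)%:Z - 1)
   + (a * t1 * t2 * t3)%:Z * ((t4 * i4)%:Z - 1)
   - (a * t2 * t3 * t4)%:Z * ((t1 * i1)%:Z - 1)
   - (a * t1 * t3 * t4)%:Z * ((t2 * i2)%:Z - 1)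
   - ((a * i3)%:Z + (a * i4)%:Z - (a * i1)%:Z - (a * i2)%:Z) * (t1 * t2 * t3 * t4)%:Z.
  by rewrite !PoszM !PoszD; ring.
by rewrite 3?rpredB 1?rpredD ?(dvdz_mulr _ h) ?(dvdz_mull _ d1) ?(dvdz_mull _ d2)
  ?(dvdz_mull _ d3) ?(dvdz_mull _ d4).
Qed.

Lemma conjc_sum (R : realType) (r : seq nat) (F : nat -> R[i]) :
  ((\sum_(t <- r) F t)^*)%C = \sum_(t <- r) ((F t)^*)%C.
Proof. exact: (rmorph_sum (@conjc R)). Qed.

Lemma expsum_fourth_moment (R : realType) (q a : nat) (r : seq nat)
    (f : nat -> R) : (0 < q)%N -> coprime a q ->
    {in r, forall t, coprime t q} -> (forall n, `|f n| <= 1) ->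
  \sum_(0 <= u < q) expsum q a r f u ^+ 4 <= q%:R * (energy q r)%:R.
Proof.
move=> q_gt0 ca cr f_le1.
pose F u t : R[i] := (f t)%:C%C * ek R q (- (u * a * modinv q t)%:Z).
pose g t1 t2 t3 t4 : R[i] := (f t1)%:C%C * (f t2)%:C%C * (f t3)%:C%C * (f t4)%:C%C.
pose d t1 t2 t3 t4 : int := (a * modinv q t3)%:Z + (a * modinv q t4)%:Z
             - (a * modinv q t1)%:Z - (a * modinv q t2)%:Z.
have E4 : (\sum_(0 <= u < q) expsum q a r f u ^+ 4)%:C%C =
    \sum_(t1 <- r) \sum_(t2 <- r) \sum_(t3 <- r) \sum_(t4 <- r)
      g t1 t2 t3 t4 * \sum_(0 <= u < q) ek R q (u%:Z * d t1 t2 t3 t4).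
  rewrite rmorph_sum/=.
  transitivity (\sum_(0 <= u < q) \sum_(t1 <- r) \sum_(t2 <- r) \sum_(t3 <- r)
      \sum_(t4 <- r) g t1 t2 t3 t4 * ek R q (u%:Z * d t1 t2 t3 t4)).
    apply: eq_bigr => u _; rewrite rmorphXn/= /expsum.
    pose z := \sum_(t <- r) F u t; rewrite -/z.
    (* Opening the fourth power this way puts [t1], [t2] and [t3], [t4] on opposite sides of the
       congruence that orthogonality in [u] detects. *)
    have -> : ((normc z)%:C%C : R[i]) ^+ 4 = z * z * z^*%C * z^*%C.
      rewrite (_ : 4 = 2 * 2)%N// exprM.
      have -> : ((normc z)%:C%C : R[i]) = `|z| by case: (z).
      by rewrite sqr_normc; ring.
    rewrite /z conjc_sum mulr_suml mulr_suml mulr_suml.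
    apply: eq_bigr => t1 _.
    rewrite [F u t1 * _]mulr_sumr !mulr_suml; apply: eq_bigr => t2 _.
    rewrite [F u t1 * F u t2 * _]mulr_sumr mulr_suml; apply: eq_bigr => t3 _.
    rewrite mulr_sumr; apply: eq_bigr => t4 _.
    have FJ t : ((F u t)^*)%C = (f t)%:C%C * ek R q (u * a * modinv q t)%:Z.
      have conjM (x y : R[i]) : ((x * y)^*)%C = (x^*)%C * (y^*)%C.
        exact: (rmorphM (@conjc R)).
      by rewrite /F conjM conjc_real -ekN opprK.
    rewrite !FJ /F.
    have -> : u%:Z * d t1 t2 t3 t4 =
       - (u * a * modinv q t1)%:Z + - (u * a * modinv q t2)%:Z
       + (u * a * modinv q t3)%:Z + (u * a * modinv q t4)%:Z.
      by rewrite /d !PoszM; ring.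
    by rewrite !ekD /g; ring.
  do 4! [rewrite exchange_big/=; apply: eq_bigr => ? _].
  by rewrite mulr_sumr.
have -> : \sum_(0 <= u < q) expsum q a r f u ^+ 4 =
    normc (\sum_(0 <= u < q) expsum q a r f u ^+ 4)%:C%C.
  rewrite normc_real ger0_norm// sumr_ge0// => u _.
  by rewrite exprn_ge0// normc_ge0.
rewrite E4 /energy natr_sum mulr_sumr; apply: le_trans (ler_normc_sum _ _ _) _.
rewrite big_seq [leRHS]big_seq; apply: ler_sum => t1 /cr c1.
rewrite natr_sum mulr_sumr; apply: le_trans (ler_normc_sum _ _ _) _.
rewrite big_seq [leRHS]big_seq; apply: ler_sum => t2 /cr c2.
rewrite natr_sum mulr_sumr; apply: le_trans (ler_normc_sum _ _ _) _.
rewrite big_seq [leRHS]big_seq; apply: ler_sum => t3 /cr c3.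
rewrite natr_sum mulr_sumr; apply: le_trans (ler_normc_sum _ _ _) _.
rewrite big_seq [leRHS]big_seq; apply: ler_sum => t4 /cr c4.
rewrite ek_orth//; case: ifPn => [|_]; last first.
  by rewrite mulr0 normc0 mulr_ge0.
move=> /(energy_inverses ca c1 c2 c3 c4)->; rewrite mulr1 /g !normcM !normc_real.
have -> : normc (q%:R : R[i]) = q%:R.
  by rewrite -(rmorph_nat (real_complex R)) normc_real ger0_norm.
rewrite ger_pMl ?ltr0n// !mulr_ile1 ?mulr_ge0 ?normr_ge0//.
Qed.

(** * The nonzero frequencies *)

(** The numerator of h / q + j / D modulo 1 over the denominator q D; it is 0 exactly when the
    geometric sum has all its terms equal to 1. *)
Definition freq (q D j h : nat) : nat := ((D * h + q * j) %% (q * D))%N.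

Definition freqs (q D j : nat) : seq nat :=
  [seq h <- index_iota 0 q | (0 < freq q D j h)%N].

Lemma freqs_uniq q D j : uniq (freqs q D j).
Proof. by rewrite filter_uniq ?iota_uniq. Qed.

Lemma freq_inj q D j : (0 < D)%N ->
  {in index_iota 0 q &, injective (freq q D j)}.
Proof.
move=> D_gt0 h h'; rewrite !mem_index_iota !leq0n/= => hq hq' /eqP.
rewrite eqn_modDr !modn_small; last 2 first.
- by rewrite mulnC ltn_pmul2r.
- by rewrite mulnC ltn_pmul2r.
by rewrite eqn_pmul2l// => /eqP.
Qed.

Lemma freq_lt q D j h : (0 < q)%N -> (0 < D)%N -> (freq q D j h < q * D)%N.
Proof. by move=> q_gt0 D_gt0; rewrite ltn_mod muln_gt0 q_gt0. Qed.

Lemma freq_mod q D j h : freq q D j h = (D * h)%N %[mod q].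
Proof.
rewrite /freq modn_dvdm ?dvdn_mulr//.
by rewrite addnC [(q * j)%N]mulnC modnMDl.
Qed.

(** The hypothesis is h' t = h t' modulo [q], and the frequency of [h] is D h modulo [q]. So, for
    fixed [h] and [t'], a collision confines the product of the new frequency with [t] to one
    residue class. *)
Lemma freq_cong q D j h h' t t' : coprime t q -> coprime t' q ->
    (h' * modinv q t' = h * modinv q t %[mod q])%N ->
  (q%:Z %| (freq q D j h' * t)%:Z - (freq q D j h * t')%:Z)%Z.
Proof.
move=> /modinvP d /modinvP d' /eqP.
have fD k : (q%:Z %| (freq q D j k)%:Z - (D * k)%:Z)%Z.
  by rewrite -eqz_mod_dvd !modz_nat freq_mod.
rewrite -eqz_nat -!modz_nat eqz_mod_dvd => e.
have -> : (freq q D j h' * t)%:Z - (freq q D j h * t')%:Z =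
   t%:Z * ((freq q D j h')%:Z - (D * h')%:Z)
   - t'%:Z * ((freq q D j h)%:Z - (D * h)%:Z)
   + (D * t * t')%:Z * ((h' * modinv q t')%:Z - (h * modinv q t)%:Z)
   - (D * h' * t)%:Z * ((t' * modinv q t')%:Z - 1)
   + (D * h * t')%:Z * ((t * modinv q t)%:Z - 1).
  by rewrite !PoszM; ring.
apply: rpredD; last exact: dvdz_mull.
apply: rpredB; last exact: dvdz_mull.
apply: rpredD; last exact: dvdz_mull.
by apply: rpredB; exact: dvdz_mull.
Qed.

(** For fixed [j] the frequencies are distinct, and so are their reflections in q D. A sum over [h]
    is thus at most a sum over all integers, taken once from each end of the period. *)
Lemma sum_freqs_le (R : realType) (q D j : nat) (X G1 G2 : nat -> R) :
    (0 < q)%N -> (0 < D)%N -> (forall v, 0 <= G1 v) -> (forall v, 0 <= G2 v) ->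
    {in freqs q D j, forall h,
       X h <= G1 (freq q D j h) + G2 (q * D - freq q D j h)%N} ->
  \sum_(h <- freqs q D j) X h <=
  \sum_(1 <= v < (q * D).+1) G1 v + \sum_(1 <= v < (q * D).+1) G2 v.
Proof.
move=> q_gt0 D_gt0 G1_ge0 G2_ge0 XG.
apply: (@le_trans _ _ (\sum_(h <- freqs q D j)
    (G1 (freq q D j h) + G2 (q * D - freq q D j h)%N))).
  by rewrite big_seq [leRHS]big_seq; exact: ler_sum.
have lt_f h := freq_lt j h q_gt0 D_gt0.
rewrite big_split/=; apply: lerD.
- apply: ler_sum_inj; rewrite ?freqs_uniq ?iota_uniq//.
    move=> h h'; rewrite !mem_filter/= => /andP[_ hq] /andP[_ hq'].
    exact: freq_inj.
  move=> h; rewrite mem_filter !mem_index_iota => /andP[-> _] _ /=.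
  by rewrite ltnS ltnW.
- apply: (@ler_sum_inj _ _ _ _ _ predT (fun h => q * D - freq q D j h)%N);
    rewrite ?freqs_uniq ?iota_uniq//.
    move=> h h'; rewrite !mem_filter/= => /andP[_ hq] /andP[_ hq'] E.
    apply: (@freq_inj q D j) => //.
    by have := lt_f h; have := lt_f h'; lia.
  move=> h; rewrite mem_filter !mem_index_iota => /andP[f_gt0 _] _ /=.
  by rewrite ltnS leq_subr andbT subn_gt0.
Qed.

Lemma normc_geomsum_dist (R : realType) (A B q D j h : nat) :
    (0 < q)%N -> (0 < D)%N -> (A <= B)%N -> (0 < freq q D j h)%N ->
  normc (geomsum R A B q D j h) <=
    2 * (q * D)%:R / (minn (freq q D j h) (q * D - freq q D j h))%:R.
Proof.
move=> q_gt0 D_gt0 le_AB f_gt0.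
apply: normc_sum_ek; rewrite ?muln_gt0 ?q_gt0 ?freq_lt//.
rewrite {1}(divn_eq (D * h + q * j) (q * D)) PoszD addrK PoszM.
exact: dvdz_mull.
Qed.

Lemma normc_geomsum_size (R : realType) (A B q D j h : nat) :
  normc (geomsum R A B q D j h) <= (B - A)%:R.
Proof.
apply: le_trans (ler_normc_sum _ _ _) _.
under eq_bigr do rewrite normc_ek.
by rewrite big_const_nat iter_addr_0.
Qed.

(** The minimum is the size of a geometric sum, divided by [q], at distance [v] from 0. Products v t
    are collected into [m], with at most [tau] representations each, and [m] runs through a
    progression modulo [q]. *)
Lemma sum_inner_le (R : realType) (q D T3 n : nat) (r3 : seq nat)
    (L tau : R) : (0 < q)%N -> 0 <= L -> 0 <= tau -> uniq r3 ->
    {in r3, forall t, (0 < t <= T3)%N} ->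
    (forall m, (0 < m <= q * D * T3)%N -> (size (divisors m))%:R <= tau) ->
  \sum_(t <- r3) \sum_(1 <= v < (q * D).+1)
    (q %| v * t + n)%:R * Num.min (L / q%:R) (2 * D%:R / v%:R) <=
  tau * ((L + 2 * D%:R * T3%:R * harm R (q * D * T3)) / q%:R).
Proof.
move=> q_gt0 L_ge0 tau_ge0 r3_uniq r3_T tauP.
(* As t <= T3, the weight 2 D / v is at most 2 D T3 / m for m = v t, a function of the product
   alone. *)
pose W m : R := Num.min (L / q%:R) (2 * D%:R * T3%:R / m%:R).
have W_ge0 m : 0 <= W m by rewrite le_min !divr_ge0 ?mulr_ge0.
pose g m : R := (q %| m + n)%:R * W m.
have g_ge0 m : 0 <= g m by rewrite mulr_ge0.
apply: (@le_trans _ _ (\sum_(t <- r3) \sum_(1 <= v < (q * D).+1) g (v * t)%N)).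
  rewrite big_seq [leRHS]big_seq; apply: ler_sum => t /r3_T/andP[t_gt0 tT].
  rewrite !big_nat; apply: ler_sum => v /andP[v_gt0 _].
  rewrite /g ler_wpM2l// /W le_min ge_min lexx/= ge_min; apply/orP; right.
  rewrite natrM invfM mulrACA ler_peMr ?divr_ge0 ?mulr_ge0//.
  by rewrite ler_pdivlMr ?ltr0n// mul1r ler_nat.
apply: le_trans (@sum_mul_le_divisors R r3 (q * D * T3) (q * D) g r3_uniq _ _ g_ge0) _.
- by move=> t /r3_T/andP[].
- by move=> t /r3_T/andP[_ tT]; rewrite leq_mul2l tT orbT.
apply: (@le_trans _ _ (\sum_(1 <= m < (q * D * T3).+1) tau * g m)).
  rewrite !big_nat; apply: ler_sum => m /andP[m_gt0 mX].
  by rewrite ler_wpM2r// tauP// m_gt0 -ltnS.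
rewrite -mulr_sumr ler_wpM2l//.
have -> : \sum_(1 <= m < (q * D * T3).+1) g m =
    \sum_(1 <= m < (q * D * T3).+1 | (q %| m + n)%N) W m.
  rewrite [RHS]big_mkcond/=; apply: eq_bigr => m _; rewrite /g.
  by case: (q %| m + n)%N; rewrite ?mul1r ?mul0r.
apply: le_trans (@sum_progression_le R q n _ (L / q%:R) (2 * D%:R * T3%:R) W _ _ _ _ _) _ => //.
- by rewrite divr_ge0.
- by move=> m _; rewrite ge_min lexx.
- by move=> m _; rewrite ge_min lexx orbT.
by rewrite [leRHS]mulrDl mulrAC.
Qed.

Lemma error_fourth_power (R : realType) (A B q D a j T3 : nat) (r2 r3 : seq nat)
    (f2 : nat -> R) (L tau : R) :
    (0 < q)%N -> (0 < D)%N -> (A <= B)%N -> (B - A)%:R <= L -> 0 <= tau ->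
    coprime a q -> {in r2, forall t, coprime t q} ->
    {in r3, forall t, coprime t q} -> uniq r3 ->
    {in r3, forall t, (0 < t <= T3)%N} -> (size r3 <= T3)%N -> (0 < T3)%N ->
    (forall n, `|f2 n| <= 1) ->
    (forall m, (0 < m <= q * D * T3)%N -> (size (divisors m))%:R <= tau) ->
  (\sum_(h <- freqs q D j) \sum_(t <- r3)
      normc (geomsum R A B q D j h) / q%:R * expsum q a r2 f2 (h * modinv q t)) ^+ 4 <=
  (4 * D%:R * harm R (q * D * T3) * T3%:R) ^+ 3 *
  (2 * tau * (L + 2 * D%:R * T3%:R * harm R (q * D * T3))) * (energy q r2)%:R.
Proof.
move=> q_gt0 D_gt0 le_AB ABL tau_ge0 ca c2 c3 r3_uniq r3_T r3_size T3_gt0 f2_le1 tauP.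
have q0 : 0 < q%:R :> R by rewrite ltr0n.
have L_ge0 : 0 <= L by apply: le_trans ABL.
set H := harm R (q * D * T3); have H_ge0 : 0 <= H := harm_ge0 _ _.
pose hs := freqs q D j; pose w h : R := normc (geomsum R A B q D j h) / q%:R.
have w_ge0 h : 0 <= w h by rewrite divr_ge0 ?normc_ge0.
pose W v : R := Num.min (L / q%:R) (2 * D%:R / v%:R).
have W_ge0 v : 0 <= W v by rewrite le_min !divr_ge0 ?mulr_ge0.
have wW h : h \in hs -> w h <= W (minn (freq q D j h) (q * D - freq q D j h)).
  rewrite mem_filter => /andP[f_gt0 _]; rewrite /w /W le_min; apply/andP; split.
    rewrite ler_pM2r ?invr_gt0//.
    exact: le_trans (normc_geomsum_size _ _ _ _ _ _ _) ABL.
  rewrite ler_pdivrMr//.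
  apply: le_trans (normc_geomsum_dist _ _ _ le_AB f_gt0) _ => //.
  by rewrite natrM le_eqVlt; apply/orP; left; apply/eqP; ring.
(* The coefficients will be 1, or the indicators of a progression at points where these equal 1. *)
have w_le h (c1 c2' : R) : h \in hs -> 0 <= c1 -> 0 <= c2' -> 1 <= c1 -> 1 <= c2' ->
    w h <= c1 * W (freq q D j h) + c2' * W (q * D - freq q D j h)%N.
  move=> hh c10 c20 c11 c21; apply: le_trans (wW h hh) _; rewrite /minn.
  have h1 := ler_peMl (W_ge0 (freq q D j h)) c11.
  have h2 := ler_peMl (W_ge0 (q * D - freq q D j h)%N) c21.
  by have := W_ge0 (freq q D j h); have := W_ge0 (q * D - freq q D j h)%N; case: ifP; lra.
have sumw : \sum_(h <- hs) w h <= 4 * D%:R * H.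
  apply: le_trans (@sum_freqs_le R q D j w W W q_gt0 D_gt0 W_ge0 W_ge0 _) _.
    by move=> h hh; have := w_le h 1 1 hh; rewrite !mul1r; apply.
  have sumW : \sum_(1 <= v < (q * D).+1) W v <= 2 * D%:R * H.
    apply: (@le_trans _ _ (\sum_(1 <= v < (q * D).+1) 2 * D%:R * v%:R^-1)).
      by apply: ler_sum => v _; rewrite /W ge_min lexx orbT.
    rewrite -mulr_sumr ler_wpM2l ?mulr_ge0//.
    by apply: le_harm; rewrite leq_pmulr.
  by lra.
pose P := [seq (h, t) | h <- hs, t <- r3].
have PE (F : nat * nat -> R) :
    \sum_(p <- P) F p = \sum_(h <- hs) \sum_(t <- r3) F (h, t).
  by rewrite big_allpairs.
pose u (p : nat * nat) := ((p.1 * modinv q p.2) %% q)%N.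
have := @holder_fibre R _ P predT q (fun p => w p.1) u (expsum q a r2 f2)
  (fun p => w_ge0 p.1) (fun p => ltn_pmod _ q_gt0).
rewrite !PE /=.
under eq_bigr do under eq_bigr do rewrite expsum_mod.
move=> /le_trans; apply.
have S1 : \sum_(h <- hs) \sum_(t <- r3) w h <= 4 * D%:R * H * T3%:R.
  under eq_bigr do rewrite big_const_seq count_predT iter_addr_0 -mulr_natr.
  by rewrite -mulr_suml ler_pM ?ler_nat// sumr_ge0.
have S1_ge0 : 0 <= \sum_(h <- hs) \sum_(t <- r3) w h.
  by do 2! [apply: sumr_ge0 => ? _].
set Z := 2 * tau * (L + 2 * D%:R * T3%:R * H).
have S2 : \sum_(h <- hs) \sum_(t <- r3)
    w h * (\sum_(p <- P | u p == u (h, t)) w p.1) <= 4 * D%:R * H * T3%:R * (Z / q%:R).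
  (* Colliding pairs (h, t) and (h', t') are regrouped so that [h] and [t'] are fixed outside, while
     [h'] and [t] vary inside: this is the form that [freq_cong] turns into a progression. *)
  have -> : \sum_(h <- hs) \sum_(t <- r3) w h * (\sum_(p <- P | u p == u (h, t)) w p.1) =
     \sum_(h <- hs) \sum_(t' <- r3) w h *
       (\sum_(t <- r3) \sum_(h' <- hs) (u (h', t') == u (h, t))%:R * w h').
    apply: eq_bigr => h _; rewrite -!mulr_sumr; congr (_ * _).
    transitivity (\sum_(t <- r3) \sum_(t' <- r3) \sum_(h' <- hs)
        (u (h', t') == u (h, t))%:R * w h'); last by rewrite exchange_big.
    apply: eq_bigr => t _; rewrite big_mkcond PE exchange_big/=.
    apply: eq_bigr => t' _; apply: eq_bigr => h' _.
    by case: ifP; rewrite ?mul1r ?mul0r.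
  have inner h t' : h \in hs -> t' \in r3 ->
      \sum_(t <- r3) \sum_(h' <- hs) (u (h', t') == u (h, t))%:R * w h' <= Z / q%:R.
    move=> hh t'r; pose rho := freq q D j h.
    (* [n1] represents the negative of rho t' modulo [q]. It serves the frequencies themselves, [n2]
       their reflections in q D, for which the sign changes. *)
    pose n1 := (q.-1 * (rho * t'))%N; pose n2 := (rho * t')%N.
    apply: (@le_trans _ _ (\sum_(t <- r3)
       (\sum_(1 <= v < (q * D).+1) (q %| v * t + n1)%:R * W v +
        \sum_(1 <= v < (q * D).+1) (q %| v * t + n2)%:R * W v))).
      rewrite big_seq [leRHS]big_seq; apply: ler_sum => t tr.
      apply: sum_freqs_le => // [v|v|h' hh']; rewrite ?mulr_ge0//.
      have [E|_] := eqVneq (u (h', t')) (u (h, t)); last first.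
        by rewrite mul0r addr_ge0 ?mulr_ge0.
      rewrite mul1r; set rho' := freq q D j h'.
      have dvd : (q%:Z %| (rho' * t)%:Z - (rho * t')%:Z)%Z.
        by apply: freq_cong; [exact: c3 | exact: c3 | exact: E].
      have d1 : (q %| rho' * t + n1)%N.
        suff : (q%:Z %| (rho' * t + n1)%:Z)%Z by [].
        have -> : (rho' * t + n1)%:Z =
            (rho' * t)%:Z - (rho * t')%:Z + (rho * t')%:Z * q%:Z.
          have -> : q%:Z = q.-1%:Z + 1 by rewrite addrC -intS prednK.
          by rewrite /n1 PoszD !PoszM; ring.
        by apply: rpredD; rewrite ?dvdz_mull.
      have d2 : (q %| (q * D - rho') * t + n2)%N.
        suff : (q%:Z %| ((q * D - rho') * t + n2)%:Z)%Z by [].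
        have -> : ((q * D - rho') * t + n2)%:Z =
            (D * t)%:Z * q%:Z - ((rho' * t)%:Z - (rho * t')%:Z).
          have le_rho : (rho' <= q * D)%N by rewrite ltnW ?freq_lt.
          by rewrite /n2 PoszD PoszM -subzn// !PoszM; ring.
        by apply: rpredB; rewrite ?dvdz_mull.
      by apply: w_le; rewrite ?d1 ?d2.
    rewrite big_split/= /Z.
    have I1 := @sum_inner_le R q D T3 n1 r3 L tau q_gt0 L_ge0 tau_ge0 r3_uniq r3_T tauP.
    have I2 := @sum_inner_le R q D T3 n2 r3 L tau q_gt0 L_ge0 tau_ge0 r3_uniq r3_T tauP.
    apply: le_trans (lerD I1 I2) _; rewrite -/H.
    by rewrite le_eqVlt; apply/orP; left; apply/eqP; ring.
  apply: (@le_trans _ _ (\sum_(h <- hs) \sum_(t' <- r3) w h * (Z / q%:R))).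
    rewrite big_seq [leRHS]big_seq; apply: ler_sum => h hh.
    rewrite big_seq [leRHS]big_seq; apply: ler_sum => t' t'r.
    by rewrite ler_wpM2l// inner.
  under eq_bigr do rewrite -mulr_suml.
  by rewrite -mulr_suml ler_wpM2r ?divr_ge0 ?mulr_ge0 ?addr_ge0 ?mulr_ge0.
have S3 := expsum_fourth_moment q_gt0 ca c2 f2_le1.
have S2_ge0 : 0 <= \sum_(h <- hs) \sum_(t <- r3)
    w h * (\sum_(p <- P | u p == u (h, t)) w p.1).
  by do 2! [apply: sumr_ge0 => ? _]; rewrite mulr_ge0// sumr_ge0.
have S3_ge0 : 0 <= \sum_(0 <= u0 < q) expsum q a r2 f2 u0 ^+ 4.
  by apply: sumr_ge0 => ? _; rewrite exprn_ge0 ?normc_ge0.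
(* The saving 1 / q in the second moment cancels the factor [q] of the fourth moment. *)
apply: (@le_trans _ _ ((4 * D%:R * H * T3%:R) ^+ 2 *
   (4 * D%:R * H * T3%:R * (Z / q%:R)) * (q%:R * (energy q r2)%:R))).
  apply: ler_pM => //; first by rewrite mulr_ge0 ?sqr_ge0.
  apply: ler_pM => //; first by rewrite sqr_ge0.
  by rewrite lerXn2r// ?nnegrE// ?mulr_ge0.
rewrite le_eqVlt; apply/orP; left; apply/eqP; field.
by rewrite gt_eqF.
Qed.

Lemma ler_powR_root4 (R : realType) (x y : R) : 0 <= x -> x ^+ 4 <= y ->
  x <= y `^ (1 / 4).
Proof.
move=> x_ge0 xy; have x4 : 0 <= x ^+ 4 by exact: exprn_ge0.
have {1}-> : x = (x ^+ 4) `^ (1 / 4).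
  by rewrite -powR_mulrn// -powRrM mulrCA divff ?mulr1 ?powRr1.
by apply: ge0_ler_powR => //; rewrite ?nnegrE ?divr_ge0// (le_trans x4).
Qed.

(** * The zero frequencies *)

(** For [f] of period [D], the mean of [f] over the integers congruent to [b] modulo [q], expressed
    by those pairs (j, h) for which h / q + j / D is an integer. *)
Definition main_kernel (R : realType) (q D : nat) (f : nat -> R) (b : nat) : R[i] :=
  \sum_(0 <= j < D) \sum_(0 <= h < q | freq q D j h == 0%N)
    fcoef D f j * ek R q (- (h * b)%:Z).

Lemma main_kernel_dvd (R : realType) (q D : nat) (f : nat -> R) (b : nat) :
    (0 < q)%N -> (0 < D)%N -> (D %| q)%N -> (forall n, f (n + D)%N = f n) ->
  main_kernel q D f b = (f b)%:C%C.
Proof.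
move=> q_gt0 D_gt0 Dq f_per; rewrite (@fcoef_inversion R D)//.
apply: eq_bigr => j _; rewrite -mulr_sumr; congr (_ * _).
(* The unique [h] with frequency 0, namely - (q / D) j modulo [q]; the factor [q.-1] plays the part
   of -1. *)
pose h0 := ((q %/ D * j * q.-1) %% q)%N.
have h0_lt : h0 \in index_iota 0 q by rewrite mem_index_iota ltn_mod.
have f0 : freq q D j h0 = 0%N.
  apply/eqP; rewrite -[_ == _]/((q * D %| D * h0 + q * j)%N).
  rewrite mulnC -{2}(divnK Dq) [X in (_ + X)%N]mulnAC [X in (_ + X)%N]mulnC -mulnDr.
  rewrite dvdn_pmul2l// /dvdn /h0 modnDml.
  have -> : (q %/ D * j * q.-1 + q %/ D * j = q %/ D * j * q)%N.
    by rewrite -mulnSr prednK.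
  by rewrite modnMl.
have -> : \sum_(0 <= h < q | freq q D j h == 0%N) ek R q (- (h * b)%:Z) =
    \sum_(h <- index_iota 0 q | h == h0) ek R q (- (h * b)%:Z).
  rewrite big_seq_cond [RHS]big_seq_cond; apply: eq_bigl => h.
  case hq : (h \in _) => //=; apply/eqP/eqP => [fh|->//].
  by apply: (@freq_inj q D j); rewrite ?f0.
rewrite -big_filter filter_pred1_uniq ?iota_uniq// big_seq1.
rewrite -(ek_scale R q _ D_gt0) -(ek_scale R D (j * b)%:Z q_gt0) [(D * q)%N]mulnC.
apply: ek_eqmod.
have -> : - (h0 * b)%:Z * D%:Z - (j * b)%:Z * q%:Z = - b%:Z * (D * h0 + q * j)%:Z.
  by rewrite !PoszD !PoszM; ring.
by apply: dvdz_mull; move/eqP: f0.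
Qed.

(** If q D divides D h + q j, then D divides q j. *)
Lemma main_kernel_eq0 (R : realType) (q D : nat) (f : nat -> R) (b : nat) :
    (0 < q)%N -> (0 < D)%N ->
    (forall j, (D %| q * j)%N -> fcoef D f j = 0) ->
  main_kernel q D f b = 0.
Proof.
move=> q_gt0 D_gt0 c0; apply: big1 => j _; apply: big1 => h /eqP f0.
rewrite c0 ?mul0r//.
have : (q * D %| D * h + q * j)%N by apply/eqP.
move=> /(dvdn_trans (dvdn_mull q (dvdnn D))).
by rewrite (dvdn_addr _ (dvdn_mulr h (dvdnn D))).
Qed.

Lemma exchange_big4 (V : nmodType) (I J K H : Type) (r : seq I) (s : seq J)
    (u : seq K) (v : seq H) (Q : K -> pred H) (F : I -> J -> K -> H -> V) :
  \sum_(i <- r) \sum_(j <- s) \sum_(k <- u) \sum_(h <- v | Q k h) F i j k h =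
  \sum_(k <- u) \sum_(h <- v | Q k h) \sum_(i <- r) \sum_(j <- s) F i j k h.
Proof.
transitivity (\sum_(i <- r) \sum_(k <- u) \sum_(h <- v | Q k h) \sum_(j <- s) F i j k h).
  apply: eq_bigr => i _; rewrite exchange_big/=; apply: eq_bigr => k _.
  by rewrite exchange_big.
by rewrite exchange_big/=; apply: eq_bigr => k _; rewrite exchange_big.
Qed.

Definition tsum (R : realType) (A B q a : nat) (r2 r3 : seq nat)
    (f1 f2 f3 : nat -> R) : R :=
  \sum_(t2 <- r2) \sum_(t3 <- r3) f2 t2 * f3 t3 *
    \sum_(A <= t < B | (q%:Z %| t%:Z - (a * modinv q t2 * modinv q t3)%:Z)%Z) f1 t.

Lemma tsum_approx (R : realType) (A B q D a T3 : nat) (r2 r3 : seq nat)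
    (f1 f2 f3 K : nat -> R) (L tau : R) :
    (0 < q)%N -> (0 < D)%N -> (A <= B)%N -> (B - A)%:R <= L -> 0 <= tau ->
    coprime a q -> {in r2, forall t, coprime t q} ->
    {in r3, forall t, coprime t q} -> uniq r3 ->
    {in r3, forall t, (0 < t <= T3)%N} -> (size r3 <= T3)%N -> (0 < T3)%N ->
    (forall n, `|f1 n| <= 1) -> (forall n, `|f2 n| <= 1) ->
    (forall n, `|f3 n| <= 1) -> (forall n, f1 (n + D)%N = f1 n) ->
    (forall m, (0 < m <= q * D * T3)%N -> (size (divisors m))%:R <= tau) ->
    (forall b, main_kernel q D f1 b = (K b)%:C%C) ->
  `|tsum A B q a r2 r3 f1 f2 f3 - (B - A)%:R / q%:R *
      \sum_(t2 <- r2) \sum_(t3 <- r3)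
        f2 t2 * f3 t3 * K (a * modinv q t2 * modinv q t3)%N| <=
  D%:R * ((4 * D%:R * harm R (q * D * T3) * T3%:R) ^+ 3 *
  (2 * tau * (L + 2 * D%:R * T3%:R * harm R (q * D * T3))) *
  (energy q r2)%:R) `^ (1 / 4).
Proof.
move=> q_gt0 D_gt0 le_AB ABL tau_ge0 ca c2 c3 r3_uniq r3_T r3_size T3_gt0.
move=> f1_le1 f2_le1 f3_le1 f1_per tauP KP.
set Y := (X in D%:R * X).
pose b t2 t3 := (a * modinv q t2 * modinv q t3)%N.
pose g h : R[i] := \sum_(t2 <- r2) \sum_(t3 <- r3)
  (f2 t2)%:C%C * (f3 t3)%:C%C * ek R q (- (h * b t2 t3)%:Z).
pose term j h : R[i] := fcoef D f1 j * (q%:R^-1 * geomsum R A B q D j h) * g h.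
have tsumE : (tsum A B q a r2 r3 f1 f2 f3)%:C%C =
    \sum_(0 <= j < D) \sum_(0 <= h < q) term j h.
  rewrite rmorph_sum/=.
  transitivity (\sum_(t2 <- r2) \sum_(t3 <- r3) \sum_(0 <= j < D) \sum_(0 <= h < q)
     fcoef D f1 j * (q%:R^-1 * geomsum R A B q D j h) *
     ((f2 t2)%:C%C * (f3 t3)%:C%C * ek R q (- (h * b t2 t3)%:Z))).
    apply: eq_bigr => t2 _; rewrite rmorph_sum/=; apply: eq_bigr => t3 _.
    rewrite !rmorphM/= (@sum_progression_fourier R A B q D)// mulr_sumr.
    apply: eq_bigr => j _; rewrite mulr_sumr; apply: eq_bigr => h _.
    by rewrite -/(b t2 t3); ring.
  apply: (etrans (exchange_big4 _ _ _ _ (fun _ => xpredT) _)) => /=.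
  apply: eq_bigr => j _; apply: eq_bigr => h _.
  rewrite /term /g [RHS]mulr_sumr; apply: eq_bigr => t2 _.
  by rewrite [RHS]mulr_sumr.
have mainE : \sum_(0 <= j < D) \sum_(0 <= h < q | freq q D j h == 0%N) term j h =
    ((B - A)%:R / q%:R * \sum_(t2 <- r2) \sum_(t3 <- r3)
        f2 t2 * f3 t3 * K (b t2 t3))%:C%C.
  rewrite !rmorphM/= fmorphV/= !rmorph_nat rmorph_sum/=.
  transitivity ((B - A)%:R / q%:R * \sum_(0 <= j < D)
      \sum_(0 <= h < q | freq q D j h == 0%N) fcoef D f1 j * g h).
    rewrite mulr_sumr; apply: eq_bigr => j _; rewrite mulr_sumr.
    apply: eq_bigr => h /eqP f0; rewrite /term.
    have -> : geomsum R A B q D j h = (B - A)%:R.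
      rewrite /geomsum (eq_bigr (fun=> 1)) => [|t _]; last first.
        by apply: ek_dvd; apply: dvdz_mull; move/eqP: f0.
      by rewrite big_const_nat iter_addr_0.
    by ring.
  congr (_ * _); rewrite /g.
  transitivity (\sum_(t2 <- r2) \sum_(t3 <- r3) (f2 t2)%:C%C * (f3 t3)%:C%C *
      main_kernel q D f1 (b t2 t3)); last first.
    apply: eq_bigr => t2 _; rewrite rmorph_sum/=; apply: eq_bigr => t3 _.
    by rewrite KP !rmorphM.
  transitivity (\sum_(t2 <- r2) \sum_(t3 <- r3) \sum_(0 <= j < D)
     \sum_(0 <= h < q | freq q D j h == 0%N)
       fcoef D f1 j * ((f2 t2)%:C%C * (f3 t3)%:C%C * ek R q (- (h * b t2 t3)%:Z))).
    apply/esym/(etrans (exchange_big4 _ _ _ _ (fun j h => freq q D j h == 0%N) _)) => /=.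
    apply: eq_bigr => j _; apply: eq_bigr => h _.
    rewrite [RHS]mulr_sumr; apply: eq_bigr => t2 _.
    by rewrite [RHS]mulr_sumr.
  apply: eq_bigr => t2 _; apply: eq_bigr => t3 _.
  rewrite /main_kernel mulr_sumr; apply: eq_bigr => j _.
  by rewrite mulr_sumr; apply: eq_bigr => h _; ring.
have errE : (tsum A B q a r2 r3 f1 f2 f3 - (B - A)%:R / q%:R *
      \sum_(t2 <- r2) \sum_(t3 <- r3) f2 t2 * f3 t3 * K (b t2 t3))%:C%C =
    \sum_(0 <= j < D) \sum_(h <- freqs q D j) term j h.
  rewrite rmorphB/= -mainE tsumE -sumrB; apply: eq_bigr => j _.
  rewrite (bigID (fun h => freq q D j h == 0%N))/= addrAC subrr add0r.
  by rewrite big_filter; apply: eq_bigl => h; rewrite lt0n.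
rewrite -normc_real errE; apply: le_trans (ler_normc_sum _ _ _) _.
apply: (@le_trans _ _ (\sum_(0 <= j < D) Y)); last first.
  by rewrite big_const_nat subn0 iter_addr_0 mulr_natl.
apply: ler_sum => j _.
have E4 := @error_fourth_power R A B q D a j T3 r2 r3 f2 L tau q_gt0 D_gt0 le_AB
  ABL tau_ge0 ca c2 c3 r3_uniq r3_T r3_size T3_gt0 f2_le1 tauP.
have w_ge0 h : 0 <= normc (geomsum R A B q D j h) / q%:R.
  by rewrite divr_ge0 ?normc_ge0.
apply: le_trans (ler_powR_root4 _ E4); last first.
  by do 2! [apply: sumr_ge0 => ? _]; rewrite mulr_ge0// normc_ge0.
apply: le_trans (ler_normc_sum _ _ _) _; apply: ler_sum => h _.
have cj1 := normc_fcoef j D_gt0 f1_le1.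
rewrite /term; move: cj1; move: (fcoef D f1 j) => cj cj1.
rewrite !normcM normc_natV -mulr_sumr [_ / _]mulrC.
rewrite -mulrA; apply: (@le_trans _ _ (1 * (q%:R^-1 * normc (geomsum R A B q D j h) * normc (g h)))).
  by rewrite ler_wpM2r// !mulr_ge0 ?invr_ge0 ?normc_ge0.
rewrite mul1r ler_wpM2l// 1?mulrC//.
(* With the [t2]-sum inside, the phase depends on [h] and [t3] only through h / t3 modulo [q], the
   argument of [expsum]. *)
have -> : g h = \sum_(t3 <- r3) (f3 t3)%:C%C * \sum_(t2 <- r2)
    (f2 t2)%:C%C * ek R q (- (h * modinv q t3 * a * modinv q t2)%:Z).
  rewrite /g exchange_big/=; apply: eq_bigr => t3 _; rewrite mulr_sumr.
  apply: eq_bigr => t2 _; rewrite [(f2 t2)%:C%C * _]mulrC -mulrA /b.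
  by congr (_ * (_ * ek _ _ _)); lia.
apply: le_trans (ler_normc_sum _ _ _) _; apply: ler_sum => t3 _.
by rewrite normcM normc_real ler_piMl ?normc_ge0.
Qed.

(** * Averaging the energy over moduli *)

(* With [A = t1 + t2] and [B = t1 t2] the equation [1 / t3 + 1 / t4 = A / B]
   reads [(A t3 - B) (A t4 - B) = B ^ 2]. *)
Lemma inv_eq_factor (t1 t2 t3 t4 : nat) :
    (0 < t1)%N -> (0 < t2)%N -> (0 < t3)%N -> (0 < t4)%N ->
    ((t1 + t2) * t3 * t4 = (t3 + t4) * t1 * t2)%N ->
  exists2 u, ((t1 + t2) * t3 = t1 * t2 + u)%N &
    [/\ (0 < u)%N, (u %| (t1 * t2) ^ 2)%N & (u * t4 = t1 * t2 * t3)%N].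
Proof.
move=> p1 p2 p3 p4 E.
set A := (t1 + t2)%N in E *; set B := (t1 * t2)%N.
have B_gt0 : (0 < B)%N by rewrite muln_gt0 p1.
have {}E : (A * t3 * t4 = B * t3 + B * t4)%N by rewrite E /B; ring.
have lt3 : (B < A * t3)%N.
  by rewrite -(ltn_pmul2r p4) E -{1}[(B * t4)%N]add0n ltn_add2r muln_gt0 B_gt0.
have lt4 : (B < A * t4)%N.
  by rewrite -(ltn_pmul2r p3) mulnAC E -{1}[(B * t3)%N]addn0 ltn_add2l muln_gt0 B_gt0.
have [u uE] : exists u, (A * t3 = B + u)%N.
  by exists (A * t3 - B)%N; rewrite subnKC// ltnW.
have [v vE] : exists v, (A * t4 = B + v)%N.
  by exists (A * t4 - B)%N; rewrite subnKC// ltnW.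
exists u => //; split; first by lia.
- apply/dvdnP; exists v.
  have : (A * t3 * (A * t4) = B * (A * t3) + B * (A * t4))%N.
    have -> : (A * t3 * (A * t4) = A * (A * t3 * t4))%N by ring.
    by rewrite E; ring.
  by rewrite uE vE; nia.
- by move: E; rewrite uE mulnDl addnC => /addIn.
Qed.

(** A solution is determined by u = (t1 + t2) t3 - t1 t2, which gives [t3] and then [t4], and [u]
    divides (t1 t2)^2. *)
Lemma count_inv_eq (r : seq nat) (t1 t2 : nat) : uniq r ->
    {in r, forall t, (0 < t)%N} -> (0 < t1)%N -> (0 < t2)%N ->
  (\sum_(t3 <- r) \sum_(t4 <- r)
     ((t1 + t2) * t3 * t4 == (t3 + t4) * t1 * t2) <=
   size (divisors ((t1 * t2) ^ 2)))%N.
Proof.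
move=> r_uniq r_gt0 p1 p2.
pose z (p : nat * nat) := ((t1 + t2) * p.1 * p.2 == (p.1 + p.2) * t1 * t2)%N.
pose P := [seq p <- [seq (t3, t4) | t3 <- r, t4 <- r] | z p].
have -> : (\sum_(t3 <- r) \sum_(t4 <- r)
     ((t1 + t2) * t3 * t4 == (t3 + t4) * t1 * t2) = size P)%N.
  rewrite /P size_filter -sum1_count [RHS]big_mkcond big_allpairs/=.
  by apply: eq_bigr => t3 _; apply: eq_bigr => t4 _; rewrite /z /=; case: eqP.
have P_uniq : uniq P.
  by rewrite filter_uniq// allpairs_uniq// => -[? ?] [? ?].
have PP p : p \in P -> [/\ (0 < p.1)%N, (0 < p.2)%N &
    ((t1 + t2) * p.1 * p.2 = (p.1 + p.2) * t1 * t2)%N].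
  rewrite mem_filter => /andP[/eqP zp /allpairsP[[t3 t4] /= [h3 h4 pE]]].
  by move: zp; rewrite pE /= => ->; split=> //; exact: r_gt0.
pose phi (p : nat * nat) := ((t1 + t2) * p.1 - t1 * t2)%N.
rewrite -(size_map phi); apply: uniq_leq_size.
  rewrite map_inj_in_uniq// => -[t3 t4] [t3' t4'] /PP/= [p3 p4 E] /PP/= [p3' p4' E'].
  have [u uE [u_gt0 _ u4]] := inv_eq_factor p1 p2 p3 p4 E.
  have [u' uE' [_ _ u4']] := inv_eq_factor p1 p2 p3' p4' E'.
  rewrite /phi/= uE uE' !addKn => uu'.
  have e3 : t3 = t3'.
    by apply/eqP; rewrite -(eqn_pmul2l (_ : 0 < t1 + t2)%N) ?uE ?uE' ?uu'//; lia.
  congr (_, _) => //; apply/eqP.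
  by rewrite -(eqn_pmul2l u_gt0) u4 uu' u4' e3.
move=> _ /mapP[[t3 t4] /PP/= [p3 p4 E] ->].
have [u uE [u_gt0 u_dvd _]] := inv_eq_factor p1 p2 p3 p4 E.
by rewrite /phi/= uE addKn -dvdn_divisors// expn_gt0 muln_gt0 p1 p2.
Qed.

Lemma sumr_const_seq (R : realType) (I : Type) (r : seq I) (x : R) :
  \sum_(i <- r) x = (size r)%:R * x.
Proof. by rewrite big_const_seq count_predT iter_addr_0 mulr_natl. Qed.

(** Fix a quadruple. If the cleared difference is nonzero, the moduli counted are among its
    divisors; if it vanishes, every modulus counts, but [t1] and [t2] leave at most [tau] such
    choices of [t3] and [t4]. *)
Lemma sum_energy_le (R : realType) (qs r : seq nat) (T : nat) (tau : R) :
    uniq qs -> uniq r -> {in r, forall t, (0 < t <= T)%N} -> 0 <= tau ->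
    (forall m, (0 < m <= 2 * T ^ 4)%N -> (size (divisors m))%:R <= tau) ->
  \sum_(q <- qs) (energy q r)%:R <=
  tau * ((size r)%:R ^+ 4 + (size r)%:R ^+ 2 * (size qs)%:R).
Proof.
move=> qs_uniq r_uniq r_T tau_ge0 tauP.
pose z t1 t2 t3 t4 := ((t1 + t2) * t3 * t4 == (t3 + t4) * t1 * t2)%N.
have bound t1 t2 t3 t4 : t1 \in r -> t2 \in r -> t3 \in r -> t4 \in r ->
    \sum_(q <- qs) (inv_cong q t1 t2 t3 t4)%:R <=
    tau + (z t1 t2 t3 t4)%:R * (size qs)%:R.
  move=> /r_T/andP[p1 T1] /r_T/andP[p2 T2] /r_T/andP[p3 T3] /r_T/andP[p4 T4].
  have [zE|zN] := boolP (z t1 t2 t3 t4).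
    rewrite mul1r; apply: ler_wpDl => //.
    apply: (@le_trans _ _ (\sum_(q <- qs) 1)); last first.
      by rewrite big_const_seq count_predT iter_addr_0.
    by apply: ler_sum => q _; rewrite lern1 leq_b1.
  rewrite mul0r addr0.
  pose N := `|((t1 + t2) * t3 * t4)%:Z - ((t3 + t4) * t1 * t2)%:Z|%N.
  have N_gt0 : (0 < N)%N by rewrite absz_gt0 subr_eq0 eqz_nat.
  (* A cube of [T] bounds this difference; the fourth power makes the same [tau] valid for the
     divisors of (t1 t2)^2. *)
  have N_le : (N <= 2 * T ^ 4)%N.
    have b1 : ((t1 + t2) * t3 * t4 <= 2 * T ^ 4)%N.
      apply: (@leq_trans ((T + T) * T * T)); first by rewrite !leq_mul// leq_add.
      by rewrite addnn -mul2n !expnS expn0 muln1 -!mulnA !leq_mul// leq_pmulr//; lia.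
    have b2 : ((t3 + t4) * t1 * t2 <= 2 * T ^ 4)%N.
      apply: (@leq_trans ((T + T) * T * T)); first by rewrite !leq_mul// leq_add.
      by rewrite addnn -mul2n !expnS expn0 muln1 -!mulnA !leq_mul// leq_pmulr//; lia.
    by rewrite /N; lia.
  apply: le_trans (tauP N _); last by rewrite N_gt0.
  rewrite -natr_sum ler_nat.
  have -> : (\sum_(q <- qs) inv_cong q t1 t2 t3 t4 = size [seq q <- qs | (q %| N)%N])%N.
    rewrite size_filter -sum1_count [RHS]big_mkcond; apply: eq_bigr => q _.
    by rewrite /inv_cong dvdzE absz_nat -/N; case: ifP.
  apply: uniq_leq_size; rewrite ?filter_uniq// => q.
  by rewrite mem_filter -dvdn_divisors// => /andP[].
have -> : \sum_(q <- qs) (energy q r)%:R = \sum_(t1 <- r) \sum_(t2 <- r)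
    \sum_(t3 <- r) \sum_(t4 <- r) \sum_(q <- qs) (inv_cong q t1 t2 t3 t4)%:R :> R.
  transitivity (\sum_(q <- qs) \sum_(t1 <- r) \sum_(t2 <- r)
      \sum_(t3 <- r) \sum_(t4 <- r) (inv_cong q t1 t2 t3 t4)%:R : R).
    by apply: eq_bigr => q _; do 4! [rewrite natr_sum; apply: eq_bigr => ? _].
  by do 4! [rewrite exchange_big/=; apply: eq_bigr => ? _].
set n : R := (size r)%:R.
have inner t1 t2 : t1 \in r -> t2 \in r ->
    \sum_(t3 <- r) \sum_(t4 <- r) \sum_(q <- qs) (inv_cong q t1 t2 t3 t4)%:R <=
    n ^+ 2 * tau + tau * (size qs)%:R.
  move=> h1 h2; have /andP[p1 T1] := r_T _ h1; have /andP[p2 T2] := r_T _ h2.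
  apply: (@le_trans _ _ (\sum_(t3 <- r) \sum_(t4 <- r)
      (tau + (z t1 t2 t3 t4)%:R * (size qs)%:R))).
    rewrite big_seq [leRHS]big_seq; apply: ler_sum => t3 h3.
    by rewrite big_seq [leRHS]big_seq; apply: ler_sum => t4 h4; exact: bound.
  under eq_bigr do rewrite big_split/=.
  rewrite big_split/=; apply: lerD.
    by rewrite !sumr_const_seq -/n mulrA expr2.
  under eq_bigr do rewrite -mulr_suml.
  rewrite -mulr_suml ler_wpM2r//.
  apply: (@le_trans _ _ (size (divisors ((t1 * t2) ^ 2)))%:R).
    under eq_bigr do rewrite -natr_sum.
    rewrite -natr_sum ler_nat; apply: count_inv_eq => //.
    by move=> t /r_T/andP[].
  apply: tauP; rewrite expn_gt0 muln_gt0 p1 p2 /=.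
  apply: (@leq_trans ((T * T) ^ 2)); first by rewrite leq_exp2r// leq_mul.
  by rewrite mulnn -expnM leq_pmull.
apply: (@le_trans _ _ (\sum_(t1 <- r) \sum_(t2 <- r)
    (n ^+ 2 * tau + tau * (size qs)%:R))).
  rewrite big_seq [leRHS]big_seq; apply: ler_sum => t1 h1.
  by rewrite big_seq [leRHS]big_seq; apply: ler_sum => t2 h2; exact: inner.
rewrite !sumr_const_seq -/n.
by rewrite le_eqVlt; apply/orP; left; apply/eqP; ring.
Qed.

Lemma energy_filter (q : nat) (r : seq nat) (P : pred nat) :
  (energy q [seq t <- r | P t] <= energy q r)%N.
Proof.
have sub (F G : nat -> nat) : (forall t, F t <= G t)%N ->
    (\sum_(t <- [seq t <- r | P t]) F t <= \sum_(t <- r) G t)%N.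
  move=> FG; rewrite big_filter big_mkcond/=; apply: leq_sum => t _.
  by case: ifP.
by do 4! [apply: (sub _ _) => ?].
Qed.

(* Removing one prime at a time: the multiples of [p] in [[a, b[] are [p] times
   the integers of [[ceil(a / p), ceil(b / p)[]. *)
Lemma sum_coprime_le (R : realType) (f : nat -> R) (Bd : R) (ps : seq nat) :
    (forall m n, f (m * n)%N = f m * f n) -> (forall n, `|f n| <= 1) ->
    (forall a b, (a <= b)%N -> `|\sum_(a <= t < b) f t| <= Bd) ->
    uniq ps -> all prime ps ->
  forall a b, (a <= b)%N ->
  `|\sum_(a <= t < b | all (fun p => ~~ (p %| t)%N) ps) f t| <= 2 ^+ size ps * Bd.
Proof.
move=> fM f_le1 fBd; elim: ps => [_ _ a b ab|p ps IH /andP[p_ps ps_uniq]].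
  by rewrite mul1r; exact: fBd.
move=> /andP[p_pr ps_pr] a b ab.
have {}IH := IH ps_uniq ps_pr.
have p_gt0 := prime_gt0 p_pr.
pose c x := ((x + p.-1) %/ p)%N.
have cP x t : (c x <= t)%N = (x <= t * p)%N.
  rewrite /c; apply/idP/idP => h.
    have := ltn_ceil (x + p.-1) p_gt0.
    have := leq_mul h (leqnn p); lia.
  rewrite -ltnS ltn_divLR//; lia.
have cab : (c a <= c b)%N by rewrite cP (leq_trans ab)// -cP.
have E : \sum_(a <= t < b | all (fun p0 => ~~ (p0 %| t)%N) (p :: ps)) f t =
    \sum_(a <= t < b | all (fun p0 => ~~ (p0 %| t)%N) ps) f t -
    f p * \sum_(c a <= t < c b | all (fun p0 => ~~ (p0 %| t)%N) ps) f t.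
  apply/eqP; rewrite eq_sym subr_eq; apply/eqP.
  rewrite (bigID (fun t => (p %| t)%N))/= addrC; congr (_ + _).
    by apply: eq_bigl => t; rewrite andbC.
  rewrite mulr_sumr; under [RHS]eq_bigr do rewrite -fM.
  rewrite -big_filter -[RHS]big_filter -[RHS](big_map (fun t => p * t)%N predT f).
  apply: perm_big; apply: uniq_perm; rewrite ?filter_uniq ?iota_uniq//.
    rewrite map_inj_uniq ?filter_uniq ?iota_uniq// => t t' /eqP.
    by rewrite eqn_pmul2l// => /eqP.
  have allp t : all (fun p0 => ~~ (p0 %| p * t)%N) ps = all (fun p0 => ~~ (p0 %| t)%N) ps.
    apply: eq_in_all => p0 hp0; rewrite Euclid_dvdM ?(allP ps_pr _ hp0)//.
    rewrite dvdn_prime2 ?(allP ps_pr _ hp0)//.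
    suff /negPf -> : p0 != p by [].
    by apply: contraNneq p_ps => e; rewrite -e.
  move=> t; rewrite mem_filter mem_index_iota; apply/idP/mapP.
    move=> /andP[/andP[al /dvdnP[s tE]] /andP[ta tb]].
    exists s; last by rewrite tE mulnC.
    rewrite mem_filter mem_index_iota cP -tE ta ltnNge cP -tE -ltnNge tb.
    by rewrite -allp mulnC -tE al.
  move=> [s]; rewrite mem_filter mem_index_iota cP ltnNge cP -ltnNge.
  move=> /andP[al /andP[sa sb]] ->.
  by rewrite allp al dvdn_mulr//= mulnC sa.
rewrite E; apply: le_trans (ler_normB _ _) _; rewrite normrM exprS -mulrA mulr_natl mulr2n.
apply: lerD; first exact: IH.
apply: le_trans (IH _ _ cab).
by rewrite ler_piMl.
Qed.

(** Splitting off all powers of one prime [p], the divisors of the cofactor and their products with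
    [p] are distinct divisors, so each prime doubles the count. *)
Lemma expn_size_primes_le (n : nat) : (0 < n)%N ->
  (2 ^ size (primes n) <= size (divisors n))%N.
Proof.
elim/ltn_ind: n => n IHn n_gt0.
have [n_gt1|n_le1] := ltnP 1 n; last by case: n n_gt0 n_le1 {IHn} => [|[]].
set p := pdiv n; have p_pr : prime p by exact: pdiv_prime.
have p_gt0 := prime_gt0 p_pr.
have [m cop] := @pfactor_coprime p n p_pr n_gt0.
set e := logn p n => nE.
have m_gt0 : (0 < m)%N by move: n_gt0; rewrite nE muln_gt0 => /andP[].
have e_gt0 : (0 < e)%N by rewrite logn_gt0 mem_primes p_pr n_gt0 pdiv_dvd.
have lt_mn : (m < n)%N.
  by rewrite nE ltn_Pmulr// -{1}(exp1n e) ltn_exp2r// prime_gt1.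
have pm : ~~ (p %| m)%N by rewrite -prime_coprime.
have -> : size (primes n) = (size (primes m)).+1.
  rewrite -[RHS]/(size (p :: primes m)); apply: perm_size; apply: uniq_perm.
  - exact: primes_uniq.
  - by rewrite /= primes_uniq mem_primes (negPf pm) !andbF.
  move=> x; rewrite nE primesM ?expn_gt0 ?p_gt0// primesX// (primes_prime p_pr).
  by rewrite mem_seq1 in_cons orbC.
rewrite expnS mul2n -addnn.
apply: (@leq_trans (size (divisors m) + size (divisors m))).
  by rewrite leq_add ?IHn.
rewrite -{2}(size_map (fun d => p * d)%N (divisors m)) -size_cat.
apply: uniq_leq_size.
  rewrite cat_uniq divisors_uniq map_inj_uniq ?divisors_uniq ?andbT/=; last first.
    by move=> d d' /eqP; rewrite eqn_pmul2l// => /eqP.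
  apply/hasPn => _ /mapP[d _ ->]; rewrite -dvdn_divisors//.
  by apply: contra pm; apply: dvdn_trans; exact: dvdn_mulr.
move=> d; rewrite mem_cat -!dvdn_divisors// => /orP[dm|/mapP[d']].
  by rewrite nE dvdn_mulr.
rewrite -dvdn_divisors// => dm ->; rewrite nE mulnC dvdn_mul//.
by rewrite dvdn_exp.
Qed.

(** * Real primitive characters *)

Lemma perm_mulmod_iota (D n : nat) : (0 < D)%N -> coprime n D ->
  perm_eq [seq (n * y %% D)%N | y <- index_iota 0 D] (index_iota 0 D).
Proof.
move=> D_gt0 cop.
have u : uniq [seq (n * y %% D)%N | y <- index_iota 0 D].
  rewrite map_inj_in_uniq ?iota_uniq// => y y'.
  rewrite !mem_index_iota !leq0n/= => yD y'D /eqP.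
  wlog le_yy' : y y' yD y'D / (y <= y')%N => [hw|].
    case: (leqP y y') => [|/ltnW] le E; first exact: hw.
    by apply/esym/hw => //; rewrite eq_sym.
  rewrite eq_sym eqn_mod_dvd ?leq_mul2l ?le_yy' ?orbT// -mulnBr.
  rewrite Gauss_dvdr 1?coprime_sym// => /dvdn_leq h.
  by apply/eqP; rewrite eqn_leq le_yy' /= leqNgt; apply/negP; lia.
apply: uniq_perm; rewrite ?iota_uniq//.
have sub : {subset [seq (n * y %% D)%N | y <- index_iota 0 D] <= index_iota 0 D}.
  by move=> _ /mapP[y _ ->]; rewrite mem_index_iota ltn_mod.
by apply: (uniq_min_size u sub _).2; rewrite size_map.
Qed.

(** Substituting n y for y permutes the residues and leaves e(- j y / D) unchanged, since D divides
    (n - 1) j. So the coefficient equals f(n) times itself. *)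
Lemma fcoef_eq0 (R : realType) (D j n : nat) (f : nat -> R) : (0 < D)%N ->
    (forall m n, f (m * n)%N = f m * f n) -> (forall n, f (n + D)%N = f n) ->
    coprime n D -> (D%:Z %| (n%:Z - 1) * j%:Z)%Z -> f n != 1 ->
  fcoef D f j = 0.
Proof.
move=> D_gt0 fM f_per cop dvd fn.
pose F z : R[i] := (f z)%:C%C * ek R D (- (j * z)%:Z).
have fmod m : f (m %% D)%N = f m.
  rewrite {2}(divn_eq m D); elim: (m %/ D)%N => [|k IHk]; first by rewrite add0n.
  by rewrite IHk -[LHS]f_per mulSn; congr f; lia.
have Fmod m : F (m %% D)%N = F m.
  rewrite /F fmod; congr (_ * _); apply: ek_eqmod.
  have -> : - (j * (m %% D))%:Z - - (j * m)%:Z = (j * (m %/ D))%:Z * D%:Z.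
    by rewrite {2}(divn_eq m D) !PoszM PoszD PoszM; ring.
  exact: dvdz_mull.
have E : (f n)%:C%C * \sum_(0 <= y < D) F y = \sum_(0 <= y < D) F y.
  rewrite -[RHS](perm_big _ (perm_mulmod_iota D_gt0 cop)) big_map mulr_sumr.
  apply: eq_bigr => y _; rewrite Fmod /F fM.
  have -> : ((f n * f y)%:C = (f n)%:C * (f y)%:C)%C.
    exact: (rmorphM (real_complex R)).
  rewrite -[RHS]mulrA; congr (_ * (_ * _)).
  apply: ek_eqmod.
  have -> : - (j * y)%:Z - - (j * (n * y))%:Z = (n%:Z - 1) * j%:Z * y%:Z.
    by rewrite !PoszM; ring.
  exact: dvdz_mulr.
rewrite /fcoef; apply/eqP; rewrite mulf_eq0; apply/orP; right.
have : ((f n)%:C%C - 1) * \sum_(0 <= y < D) F y == 0.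
  by rewrite mulrBl mul1r E subrr.
rewrite mulf_eq0 => /orP[|//].
rewrite subr_eq0 => /eqP e.
by move/eqP: fn => []; apply: (@complexI R); rewrite e.
Qed.

(** The vanishing coefficient at 0 makes every full period sum to 0; what remains has at most [D]
    terms. *)
Lemma periodic_sum_le (R : realType) (D : nat) (f : nat -> R) : (0 < D)%N ->
    (forall n, f (n + D)%N = f n) -> (forall n, `|f n| <= 1) ->
    fcoef D f 0 = 0 ->
  forall a b, (a <= b)%N -> `|\sum_(a <= t < b) f t| <= D%:R.
Proof.
move=> D_gt0 f_per f_le1 c0 a.
have s0 : \sum_(0 <= t < D) f t = 0.
  move/eqP: c0; rewrite /fcoef mulf_eq0 invr_eq0 pnatr_eq0 -leqn0 leqNgt D_gt0/=.
  under eq_bigr do rewrite mul0n oppr0 ek0 mulr1.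
  by rewrite -(rmorph_sum (real_complex R)) => /eqP/(@complexI R).
have sa m : \sum_(m <= t < m + D) f t = 0.
  elim: m => [|m IHm]; first by rewrite add0n.
  move: IHm; rewrite big_ltn; last by rewrite -{1}[m]addn0 ltn_add2l.
  rewrite addSn big_nat_recr/=; last by rewrite -addn1 leq_add2l.
  by rewrite f_per addrC.
elim/ltn_ind => b IHb ab.
have [le_D|lt_D] := leqP (b - a) D.
  apply: le_trans (ler_norm_sum _ _ _) _.
  apply: (@le_trans _ _ (\sum_(a <= t < b) 1)); first by apply: ler_sum.
  by rewrite big_const_nat iter_addr_0 ler_nat.
have ab1 : (a <= b - D)%N by lia.
have ab2 : (b - D <= b)%N by lia.
have := sa (b - D)%N; rewrite subnK => [sb|]; last by lia.
by rewrite (big_cat_nat ab1 ab2)/= sb addr0; apply: IHb; lia.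
Qed.

Lemma coprime_all_primes (q t : nat) : (0 < q)%N -> (0 < t)%N ->
  coprime t q = all (fun p => ~~ (p %| t)%N) (primes q).
Proof.
move=> q_gt0 t_gt0; rewrite coprime_has_primes// -all_predC.
apply: eq_in_all => p; rewrite mem_primes => /and3P[p_pr _ _].
by rewrite /= mem_primes p_pr t_gt0.
Qed.

(** The fourth item says that a quadratic character takes the same value at a residue and at its
    inverse. The last says that coefficients at a zero frequency vanish unless D divides q. *)
Lemma char_properties (R : realType) (D : nat) (chi : int -> R) :
    dirichlet_character D chi -> quadratic_character D chi ->
    primitive_character D chi ->
  let f n := chi n%:Z in
  [/\ forall m n, f (m * n)%N = f m * f n,
      forall n, f (n + D)%N = f n,
      forall n, `|f n| <= 1,
      forall n m, coprime n D -> (D%:Z %| (n * m)%:Z - 1)%Z -> f m = f n &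
      fcoef D f 0 = 0 /\
      forall q j, ~~ (D %| q)%N -> (D %| q * j)%N -> fcoef D f j = 0].
Proof.
move=> [D_gt0 chiM chi_per chi0] [chi2 [n0 cn0 n01]] prim f.
have fM m n : f (m * n)%N = f m * f n by rewrite /f PoszM chiM.
have f_per n : f (n + D)%N = f n by rewrite /f PoszD chi_per.
have chi_per' (n : int) (k : nat) : chi (n + k%:Z * D%:Z) = chi n.
  elim: k => [|k IHk]; first by rewrite mul0r addr0.
  by rewrite -addn1 PoszD mulrDl mul1r addrA chi_per.
have chi_mod (n : int) : chi (n %% D%:Z)%Z = chi n.
  rewrite {2}(divz_eq n D%:Z); case: (n %/ D%:Z)%Z => k.
    by rewrite addrC chi_per'.
  by rewrite -[RHS](chi_per' _ k.+1) NegzE; congr chi; ring.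
have chi_eq (m n : int) : (D%:Z %| m - n)%Z -> chi m = chi n.
  by rewrite -eqz_mod_dvd => /eqP e; rewrite -chi_mod e chi_mod.
have f1 : f 1%N = 1.
  have : f 1%N != 0 by rewrite /f chi0 coprimezE coprime1n.
  by move=> /mulIf; apply; rewrite mul1r -fM.
have f_le1 n : `|f n| <= 1.
  have [c|nc] := boolP (coprimez n%:Z D%:Z).
    by rewrite -(@ler_pXn2r _ 2) ?nnegrE// -normrX chi2// normr1 expr1n.
  have -> : f n = 0 by apply/eqP; rewrite -[_ == _]negbK chi0.
  by rewrite normr0.
have natrep (n : int) : coprimez n D%:Z -> chi n != 1 ->
    exists n' : nat, [/\ coprime n' D, f n' != 1 & (D%:Z %| n'%:Z - n)%Z].
  move=> cn n1; exists `|(n %% D%:Z)%Z|%N.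
  have E : `|(n %% D%:Z)%Z|%N%:Z = (n %% D%:Z)%Z.
    by rewrite gez0_abs// modz_ge0// -lt0n.
  split.
  - rewrite -[coprime _ _]/(coprimez (n %% D%:Z)%Z D%:Z) /coprimez.
    by move: cn; rewrite /coprimez gcdz_modl.
  - by rewrite /f E chi_mod.
  - by rewrite E -eqz_mod_dvd modz_mod.
split=> // [n m cn dvd|].
  have e : f n * f m = 1 by rewrite -fM /f (chi_eq _ 1).
  have : f n ^+ 2 = 1 by rewrite /f chi2.
  have fn0 : f n != 0 by rewrite /f chi0.
  by rewrite expr2 -e => /(mulfI fn0).
have [n [cn fn _]] := natrep _ cn0 n01.
split; first by apply: (fcoef_eq0 _ fM f_per cn _ fn); rewrite ?mulr0 ?dvdz0.
move=> q j Dq Dqj.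
have g_gt0 : (0 < gcdn j D)%N by rewrite gcdn_gt0 D_gt0 orbT.
have dD : (D %/ gcdn j D * gcdn j D = D)%N by rewrite divnK ?dvdn_gcdr.
(* If [j] were prime to [D], then D would divide q. *)
have g_neq1 : gcdn j D != 1%N.
  apply: contra Dq => g1; move: Dqj; rewrite Gauss_dvdl// coprime_sym.
  exact: g1.
(* Primitivity at the proper divisor D / gcd(j, D) gives an [m] congruent to 1 there with character
   value different from 1; then D divides (m - 1) j, as [fcoef_eq0] requires. *)
have [||m [cm /eqP m1 fm]] := prim (D %/ gcdn j D)%N.
- by apply/dvdnP; exists (gcdn j D); rewrite mulnC dD.
- by rewrite ltn_Pdiv// ltn_neqAle eq_sym g_neq1.
have [n' [cn' fn' dvd]] := natrep _ cm fm.
apply: (fcoef_eq0 _ fM f_per cn' _ fn') => //.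
rewrite eqz_mod_dvd in m1.
have -> : (n'%:Z - 1) * j%:Z = (n'%:Z - m) * j%:Z + (m - 1) * j%:Z by ring.
apply: rpredD; first exact: dvdz_mulr.
have -> : D%:Z = (D %/ gcdn j D)%:Z * (gcdn j D)%:Z by rewrite -PoszM dD.
apply: dvdz_mul => //.
exact: dvdn_gcdl.
Qed.

(** * The bound for a single modulus *)

Definition error_bound (R : realType) (D T3 : nat) (H tau L : R) (E : nat) : R :=
  D%:R * ((4 * D%:R * H * T3%:R) ^+ 3 *
    (2 * tau * (L + 2 * D%:R * T3%:R * H)) * E%:R) `^ (1 / 4).

Lemma le_error_bound (R : realType) (D D' T3 : nat) (H H' tau L : R) (E E' : nat) :
    (D <= D')%N -> 0 <= H <= H' -> 0 <= tau -> 0 <= L -> (E <= E')%N ->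
  error_bound D T3 H tau L E <= error_bound D' T3 H' tau L E'.
Proof.
move=> DD' /andP[H0 HH'] tau0 L0 EE'; rewrite /error_bound.
have H'0 : 0 <= H' by exact: le_trans HH'.
have D0 : 0 <= D%:R :> R by [].
have DD : D%:R <= D'%:R :> R by rewrite ler_nat.
apply: ler_pM; rewrite ?powR_ge0//.
apply: ge0_ler_powR; rewrite ?nnegrE ?divr_ge0 ?mulr_ge0 ?exprn_ge0 ?addr_ge0 ?mulr_ge0//.
apply: ler_pM; rewrite ?mulr_ge0 ?exprn_ge0 ?addr_ge0 ?mulr_ge0 ?ler_nat//.
apply: ler_pM; rewrite ?mulr_ge0 ?exprn_ge0 ?addr_ge0 ?mulr_ge0//.
  rewrite lerXn2r ?nnegrE ?mulr_ge0// ler_wpM2r//.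
  by apply: ler_pM; rewrite ?mulr_ge0// ler_wpM2l.
rewrite ler_wpM2l ?mulr_ge0// lerD2l.
by apply: ler_pM; rewrite ?mulr_ge0// ler_wpM2r// ler_wpM2l.
Qed.

Lemma tsum_bound (R : realType) (A1 B1 A2 B2 A3 B3 q D a T3 N : nat)
    (chi f1 f2 f3 : int -> R) (L tau : R) :
    dirichlet_character D chi -> quadratic_character D chi ->
    primitive_character D chi -> exactly_one_is chi f1 f2 f3 ->
    (0 < q)%N -> (A1 <= B1)%N -> (A2 <= B2)%N -> (A3 <= B3)%N ->
    (0 < A2)%N -> (0 < A3)%N -> (B1 - A1)%:R <= L -> coprime a q ->
    (B3 <= T3)%N -> (0 < T3)%N -> (B2 - A2 <= N)%N -> (B3 - A3 <= N)%N ->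
    (forall m, (0 < m <= q * D * T3)%N -> (size (divisors m))%:R <= tau) ->
  `|tsum A1 B1 q a [seq t <- index_iota A2 B2 | coprime t q]
      [seq t <- index_iota A3 B3 | coprime t q]
      (fun n => f1 n%:Z) (fun n => f2 n%:Z) (fun n => f3 n%:Z)| <=
  L / q%:R * (D%:R * tau * N%:R) +
  error_bound D T3 (harm R (q * D * T3)) tau L (energy q (index_iota A2 B2)).
Proof.
move=> hchi hquad hprim one q_gt0 AB1 AB2 AB3 A2_gt0 A3_gt0 L1 ca BT T3_gt0 N2 N3 tauP.
have D_gt0 : (0 < D)%N by case: hchi.
have [fM f_per f_le1 f_inv [c0 cprim]] := char_properties hchi hquad hprim.
pose f (n : nat) : R := chi n%:Z.
have {}fM m n : f (m * n)%N = f m * f n := fM m n.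
have {}f_inv n m : coprime n D -> (D%:Z %| (n * m)%:Z - 1)%Z -> f m = f n := f_inv n m.
set r2 := [seq t <- index_iota A2 B2 | coprime t q].
set r3 := [seq t <- index_iota A3 B3 | coprime t q].
have q0 : 0 < q%:R :> R by rewrite ltr0n.
have L0 : 0 <= L by exact: le_trans L1.
have qX : (0 < q <= q * D * T3)%N by rewrite q_gt0 -mulnA leq_pmulr// muln_gt0 D_gt0.
have tau0 : 0 <= tau by exact: le_trans (tauP _ qX).
(* Sieving by the primes of [q] costs a factor 2 for each, hence at most the number of divisors of
   [q]. *)
have csum A B : (0 < A)%N -> (A <= B)%N ->
    `|\sum_(t <- [seq t <- index_iota A B | coprime t q]) f t| <= D%:R * tau.
  move=> A_gt0 AB; rewrite big_filter.
  have -> : \sum_(A <= t < B | coprime t q) f t =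
      \sum_(A <= t < B | all (fun p => ~~ (p %| t)%N) (primes q)) f t.
    rewrite big_seq_cond [RHS]big_seq_cond; apply: eq_bigl => t.
    rewrite mem_index_iota; case: (leqP A t) => //= At.
    by rewrite coprime_all_primes// (leq_trans A_gt0).
  apply: le_trans (@sum_coprime_le R f D%:R (primes q) fM f_le1
      (periodic_sum_le D_gt0 f_per f_le1 c0) (primes_uniq q) _ A B AB) _.
    by apply/allP => p; rewrite mem_primes => /andP[].
  rewrite mulrC ler_wpM2l//; apply: le_trans (tauP _ qX).
  by rewrite -natrX ler_nat expn_size_primes_le.
have c2 : {in r2, forall t, coprime t q} by move=> t; rewrite mem_filter => /andP[].
have c3 : {in r3, forall t, coprime t q} by move=> t; rewrite mem_filter => /andP[].
have r3_uniq : uniq r3 by rewrite filter_uniq ?iota_uniq.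
have r3_T : {in r3, forall t, (0 < t <= T3)%N}.
  move=> t; rewrite mem_filter mem_index_iota => /and3P[_ At tB].
  by rewrite (leq_trans A3_gt0)//= (leq_trans (ltnW tB)).
have s2 : (size r2 <= N)%N.
  by rewrite size_filter (leq_trans (count_size _ _))// size_iota.
have s3 : (size r3 <= N)%N.
  by rewrite size_filter (leq_trans (count_size _ _))// size_iota.
have s3T : (size r3 <= T3)%N.
  by rewrite size_filter (leq_trans (count_size _ _))// size_iota; lia.
have one_le1 : forall n : nat, `|cst 1 n%:Z : R| <= 1 by move=> n; rewrite /cst normr1.
(* [D1] is the period at which the first function is expanded: [D] for the character, 1 for the
   constant. *)
have combine D1 (g1 g2 g3 K : nat -> R) : (0 < D1 <= D)%N ->
    (forall n, `|g1 n| <= 1) -> (forall n, `|g2 n| <= 1) ->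
    (forall n, `|g3 n| <= 1) -> (forall n, g1 (n + D1)%N = g1 n) ->
    (forall b, main_kernel q D1 g1 b = (K b)%:C%C) ->
    `|\sum_(t2 <- r2) \sum_(t3 <- r3) g2 t2 * g3 t3 *
        K (a * modinv q t2 * modinv q t3)%N| <= D%:R * tau * N%:R ->
    `|tsum A1 B1 q a r2 r3 g1 g2 g3| <= L / q%:R * (D%:R * tau * N%:R) +
      error_bound D T3 (harm R (q * D * T3)) tau L (energy q (index_iota A2 B2)).
  move=> /andP[D1_gt0 D1D] g1_le1 g2_le1 g3_le1 g1_per KP mainP.
  have leX : (q * D1 * T3 <= q * D * T3)%N by rewrite leq_mul// leq_mul.
  have tauP' m : (0 < m <= q * D1 * T3)%N -> (size (divisors m))%:R <= tau.
    by move=> /andP[m_gt0 mX]; apply: tauP; rewrite m_gt0 (leq_trans mX).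
  have := tsum_approx q_gt0 D1_gt0 AB1 L1 tau0 ca c2 c3 r3_uniq r3_T s3T T3_gt0
    g1_le1 g2_le1 g3_le1 g1_per tauP' KP.
  set S := tsum _ _ _ _ _ _ _ _ _.
  set Mn := (\sum_(t2 <- r2) \sum_(t3 <- r3) _) in mainP *.
  move=> app; rewrite -[S](subrK ((B1 - A1)%:R / q%:R * Mn)) addrC.
  apply: le_trans (ler_normD _ _) _; apply: lerD.
    rewrite normrM ger0_norm ?divr_ge0//.
    by apply: ler_pM; rewrite ?divr_ge0// ler_pM2r ?invr_gt0.
  apply: (le_trans app); apply: le_error_bound => //; last exact: energy_filter.
  by rewrite harm_ge0 le_harm.
have prodsum (g2 g3 : nat -> R) (c : R) :
   \sum_(t2 <- r2) \sum_(t3 <- r3) g2 t2 * g3 t3 * c =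
   c * ((\sum_(t2 <- r2) g2 t2) * (\sum_(t3 <- r3) g3 t3)).
  rewrite mulr_suml mulr_sumr; apply: eq_bigr => t2 _.
  by rewrite !mulr_sumr; apply: eq_bigr => t3 _; ring.
have sumc1 (r : seq nat) : \sum_(t <- r) (cst 1 t%:Z : R) = (size r)%:R.
  by rewrite /cst sumr_const_seq mulr1.
case: one => [[-> -> ->]|[-> -> ->]|[-> -> ->]].
- have [Dq|nDq] := boolP (D %| q)%N; last first.
    apply: (combine D _ _ _ (fun=> 0)) => //; rewrite ?D_gt0 ?leqnn//.
      by move=> b; rewrite main_kernel_eq0// => j; exact: cprim.
    by rewrite prodsum mul0r normr0 !mulr_ge0.
  apply: (combine D _ _ _ f) => //; rewrite ?D_gt0 ?leqnn//.
    by move=> b; exact: main_kernel_dvd.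
  (* When D divides q, the mean is chi(a / (t2 t3)) = chi(a) chi(t2) chi(t3), so the double sum
     factors and the [t2]-sum already shows cancellation. *)
  have finv t : coprime t q -> f (modinv q t) = f t.
    move=> ct; apply: f_inv; first exact: coprime_dvdr Dq ct.
    by apply: dvdz_trans (modinvP ct); exact: Dq.
  have -> : \sum_(t2 <- r2) \sum_(t3 <- r3) cst 1 t2%:Z * cst 1 t3%:Z *
      f (a * modinv q t2 * modinv q t3)%N =
      \sum_(t2 <- r2) \sum_(t3 <- r3) f t2 * f t3 * f a.
    rewrite big_seq [RHS]big_seq; apply: eq_bigr => t2 h2.
    rewrite big_seq [RHS]big_seq; apply: eq_bigr => t3 h3.
    rewrite !fM (finv _ (c2 _ h2)) (finv _ (c3 _ h3)) /cst.
    move: (f a) (f t2) (f t3) => x y z; lazy beta; ring.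
  rewrite (prodsum f f (f a)) !normrM.
  apply: (@le_trans _ _ (1 * (D%:R * tau * N%:R))); last by rewrite mul1r.
  apply: ler_pM; [exact: normr_ge0 | exact: mulr_ge0 | exact: f_le1 |].
  apply: ler_pM; [exact: normr_ge0 | exact: normr_ge0 | exact: csum |].
  apply: le_trans (ler_norm_sum _ _ _) _.
  apply: (@le_trans _ _ (\sum_(t <- r3) 1)); first by apply: ler_sum => t _; exact: f_le1.
  by rewrite sumr_const_seq mulr1 ler_nat.
(* With f1 = 1 the kernel is 1, and the cancellation comes from the sum over the variable that
   carries the character. *)
- apply: (combine 1%N _ _ _ (fun=> 1)) => //.
    by move=> b; rewrite (@main_kernel_dvd R q 1 (fun n => cst 1 n%:Z)).
  rewrite prodsum mul1r normrM sumc1 normr_nat.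
  by apply: ler_pM; rewrite ?ler_nat//; exact: csum.
- apply: (combine 1%N _ _ _ (fun=> 1)) => //.
    by move=> b; rewrite (@main_kernel_dvd R q 1 (fun n => cst 1 n%:Z)).
  rewrite prodsum mul1r normrM sumc1 normr_nat mulrC.
  by apply: ler_pM; rewrite ?ler_nat//; exact: csum.
Qed.

(** * Real intervals as ranges of natural numbers *)

Definition nceil (R : realType) (x : R) : nat := `|Num.ceil x|%N.

Lemma nceilE (R : realType) (x : R) : 0 < x -> (nceil x)%:Z = Num.ceil x.
Proof. by move=> x_gt0; rewrite gez0_abs// ltW// ceil_gt0. Qed.

Lemma nceil_le (R : realType) (x : R) (n : nat) : 0 < x ->
  (nceil x <= n)%N = (x <= n%:R).
Proof. by move=> x_gt0; rewrite -lez_nat nceilE// ceil_le_int -pmulrn. Qed.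

Lemma nceil_ge (R : realType) (x : R) : 0 < x -> x <= (nceil x)%:R.
Proof. by move=> x_gt0; rewrite -nceil_le. Qed.

Lemma short_intervalE (R : realType) (M Delta : R) (t : int) :
    0 < M -> 0 < Delta ->
  short_interval M Delta t <->
  t \in map Posz (index_iota (nceil M) (nceil (M * (1 + Delta)))).
Proof.
move=> M_gt0 Delta_gt0; have M'_gt0 : 0 < M * (1 + Delta).
  by rewrite mulr_gt0// addr_gt0.
split=> [/andP[Mt tM]|/mapP[n + ->]].
  case: t Mt tM => n Mt tM; last first.
    have := lt_le_trans M_gt0 Mt; rewrite NegzE ltr0z.
    by lia.
  apply/mapP; exists n => //; rewrite mem_index_iota nceil_le// ltnNge nceil_le//.
  by rewrite -ltNge !pmulrn Mt.
by rewrite mem_index_iota nceil_le// ltnNge nceil_le// -ltNge /short_interval/= -pmulrn.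
Qed.

(** As [a] is a unit modulo [q], the congruence itself forces [t2] and [t3] to be prime to [q], and
    it can be solved for [t1]. *)
Lemma ternary_sum_tsum (R : realType) (M1 M2 M3 Delta : R) (f1 f2 f3 : int -> R)
    (a q : nat) : 0 < M1 -> 0 < M2 -> 0 < M3 -> 0 < Delta -> coprime a q ->
  ternary_sum M1 M2 M3 Delta f1 f2 f3 a%:Z q =
  tsum (nceil M1) (nceil (M1 * (1 + Delta))) q a
    [seq t <- index_iota (nceil M2) (nceil (M2 * (1 + Delta))) | coprime t q]
    [seq t <- index_iota (nceil M3) (nceil (M3 * (1 + Delta))) | coprime t q]
    (fun n => f1 n%:Z) (fun n => f2 n%:Z) (fun n => f3 n%:Z).
Proof.
move=> M1_gt0 M2_gt0 M3_gt0 Delta_gt0 ca.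
pose I M := index_iota (nceil M) (nceil (M * (1 + Delta))).
pose P (t : int * int * int) := (t.1.1 * t.1.2 * t.2 == a%:Z %[mod q%:Z])%Z.
pose r := [seq t <- [seq (p, t3) | p <- [seq (t1, t2) | t1 <- map Posz (I M1),
   t2 <- map Posz (I M2)], t3 <- map Posz (I M3)] | P t].
have r_uniq : uniq r.
  have uI M : uniq (map Posz (I M)) by rewrite map_inj_uniq ?iota_uniq// => ? ? [].
  rewrite filter_uniq// allpairs_uniq//; last by move=> [? ?] [? ?].
  by rewrite allpairs_uniq//; move=> [? ?] [? ?].
have setE : [set t : int * int * int |
          [/\ short_interval M1 Delta t.1.1,
              short_interval M2 Delta t.1.2,
              short_interval M3 Delta t.2
            & (t.1.1 * t.1.2 * t.2 = a%:Z %[mod q%:Z])%Z]] = [set` r].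
  apply/seteqP; split=> -[[t1 t2] t3] /=.
    move=> [/short_intervalE h1 /short_intervalE h2 /short_intervalE h3 /eqP cong].
    rewrite mem_filter; apply/andP; split=> //.
    by rewrite allpairs_f// ?h3// allpairs_f// ?h1 ?h2.
  rewrite mem_filter => /andP[/eqP cong].
  move=> /allpairsP[[[u1 u2] u3] /= [+ h3 [e1 e2 e3]]].
  move=> /allpairsP[[v1 v2] /= [h1 h2 [e4 e5]]].
  subst t1 t2 t3 u1 u2.
  split; [by apply/short_intervalE | by apply/short_intervalE |
          by apply/short_intervalE | exact: cong].
rewrite /ternary_sum setE -fsbig_seq// big_filter big_mkcond big_allpairs/= big_allpairs/=.
rewrite big_map.
under eq_bigr do rewrite big_map.
under eq_bigr do under eq_bigr do rewrite big_map.
pose F t1 t2 t3 : R := if (q%:Z %| (t1 * t2 * t3)%:Z - a%:Z)%Z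
  then f1 t1%:Z * f2 t2%:Z * f3 t3%:Z else 0.
transitivity (\sum_(t1 <- I M1) \sum_(t2 <- I M2) \sum_(t3 <- I M3) F t1 t2 t3).
  apply: eq_bigr => t1 _; apply: eq_bigr => t2 _; apply: eq_bigr => t3 _.
  by rewrite /P /= eqz_mod_dvd /F !PoszM.
have F0 t1 t2 t3 : ~~ (coprime t2 q && coprime t3 q) -> F t1 t2 t3 = 0.
  move=> nc; rewrite /F ifF//; apply: contraNF nc => dvd.
  have : coprime (t1 * t2 * t3) q.
    move: dvd; rewrite -eqz_mod_dvd !modz_nat => /eqP[e].
    by rewrite -coprime_modl e coprime_modl.
  by rewrite !coprimeMl => /andP[/andP[_ ->] ->].
rewrite exchange_big/= /tsum big_filter [RHS]big_mkcond/=.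
apply: eq_bigr => t2 _; rewrite exchange_big/=; case: ifPn => c2; last first.
  by rewrite big1// => t3 _; rewrite big1// => t1 _; rewrite F0// (negPf c2).
rewrite big_filter [RHS]big_mkcond/=; apply: eq_bigr => t3 _.
case: ifPn => c3; last by rewrite big1// => t1 _; rewrite F0// (negPf c3) andbF.
rewrite mulr_sumr [RHS]big_mkcond; apply: eq_bigr => t1 _.
rewrite /F (ternary_cong_modinv _ _ c2 c3); case: ifP => // _.
by rewrite -mulrA mulrC.
Qed.

(** * Choice of parameters *)

Lemma harm_le_ln (R : realType) (X : nat) : (0 < X)%N ->
  harm R X <= 1 + ln X%:R.
Proof.
case: X => // X _; elim: X => [|X IHX].
  by rewrite /harm big_nat1 ln1 addr0 invr1.
rewrite /harm big_nat_recr//=; set S := \sum_(_ <= _ < _) _.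
have S_le : S <= 1 + ln X.+1%:R by exact: IHX.
have X1 : 0 < X.+1%:R :> R by rewrite ltr0n.
have X2 : 0 < X.+2%:R :> R by rewrite ltr0n.
suff : X.+2%:R^-1 <= ln X.+2%:R - ln X.+1%:R :> R.
  by move=> /(lerD S_le); rewrite -addrA [ln X.+1%:R + _]addrC subrK.
have E : X.+1%:R / X.+2%:R = 1 + - X.+2%:R^-1 :> R.
  have -> : X.+1%:R = X.+2%:R - 1 :> R by rewrite -[X.+2%:R]natr1 addrK.
  by rewrite mulrBl divff ?gt_eqF// mul1r.
have lt1 : -1 < - X.+2%:R^-1 :> R by rewrite ltrN2 invf_lt1// ltr1n.
by have := le_ln1Dx lt1; rewrite -E ln_div ?posrE// => h;
  rewrite -[leRHS]opprB lerNr.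
Qed.

(** ln X <= X^d / d, from ln (1 + y) <= y at y = X^d - 1. *)
Lemma harm_le_powR (R : realType) (d : R) (X : nat) : 0 < d -> (0 < X)%N ->
  harm R X <= (1 + d^-1) * X%:R `^ d.
Proof.
move=> d_gt0 X_gt0; apply: le_trans (harm_le_ln R X_gt0) _.
have X1 : 1 <= X%:R :> R by rewrite ler1n.
have p1 : 1 <= X%:R `^ d :> R by have := ler_powR X1 (ltW d_gt0); rewrite powRr0.
rewrite mulrDl mul1r lerD// ler_pdivlMl// -ln_powR.
have lt1 : -1 < X%:R `^ d - 1 by lra.
by have := le_ln1Dx lt1; rewrite addrCA subrr addr0; lra.
Qed.

Lemma powRDp (R : realType) (x r s : R) : 0 < x -> x `^ (r + s) = x `^ r * x `^ s.
Proof. by move=> x_gt0; rewrite powRD// (gt_eqF x_gt0) implybT. Qed.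

(** Otherwise q <= x^(41/100), where the factor 2 is covered by x^(1/100) since 2^100 <= x. As
    (41/100)(3/2 + alpha) <= 62/100, the two bounds on [M] would give x <= x^(1/3 + 62/100). *)
Lemma modulus_lower_bound (R : realType) (alpha x q M : R) :
    0 < alpha < 1 / 100 -> 2 ^+ 100 <= x -> 1 <= q ->
    x / q `^ (3 / 2 + alpha) <= M -> M <= x `^ (1 / 3) ->
  x `^ (2 / 5) <= q / 2.
Proof.
move=> /andP[a0 a1] x_big q1 xM Mx; rewrite leNgt; apply/negP => q_small.
have x1 : 1 <= x by apply: le_trans x_big; rewrite exprn_ege1// ler1n.
have x0 : 0 < x by rewrite (lt_le_trans ltr01).
have two_le : 2 <= x `^ (1 / 100).
  have {1}-> : 2 = (2 ^+ 100) `^ (1 / 100) :> R.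
    by rewrite -powR_mulrn// -powRrM mulrCA divff ?mulr1 ?powRr1.
  apply: ge0_ler_powR; rewrite ?nnegrE ?divr_ge0 ?exprn_ge0// ltW//.
have q_le : q <= x `^ (41 / 100).
  have -> : 41 / 100 = 1 / 100 + 2 / 5 :> R by lra.
  rewrite powRDp//.
  have p0 : 0 <= x `^ (2 / 5) by exact: powR_ge0.
  by nra.
have q_pow : q `^ (3 / 2 + alpha) <= x `^ (62 / 100).
  apply: (@le_trans _ _ ((x `^ (41 / 100)) `^ (3 / 2 + alpha))).
    by apply: ge0_ler_powR; rewrite ?nnegrE ?powR_ge0//; lra.
  by rewrite -powRrM ler_powR//; nra.
have qp0 : 0 < q `^ (3 / 2 + alpha) by rewrite powR_gt0//; lra.
have : x <= x `^ (1 / 3) * x `^ (62 / 100).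
  move: (le_trans xM Mx); rewrite ler_pdivrMr// => /le_trans; apply.
  by rewrite ler_wpM2l ?powR_ge0.
rewrite -powRDp// leNgt => /negP; apply.
rewrite -{2}(powRr1 (ltW x0)).
have x_gt1 : 1 < x.
  by apply: lt_le_trans x_big; rewrite exprn_egt1// ltr1n.
rewrite /powR gt_eqF// ltr_expR ltr_pM2r ?ln_gt0//; lra.
Qed.

(** Raise the bound on d^2 Q to the power 3/2 + alpha: since (2/3 - 4 alpha)(3/2 + alpha) <= 1 - 5
    alpha, a factor x^(5 alpha) is left over. One x^alpha of it absorbs the 4 coming from q <= 2
    Q. *)
Lemma third_factor_lower_bound (R : realType) (alpha x q Q M d : R) :
    0 < alpha < 1 / 100 -> 1 <= x -> 4 <= x `^ alpha -> 1 <= d -> 0 < Q ->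
    0 < q <= 2 * Q -> d ^+ 2 * Q < x `^ (2 / 3 - 4 * alpha) ->
    x / q `^ (3 / 2 + alpha) <= M ->
  x `^ (4 * alpha) * d <= M.
Proof.
move=> /andP[a0 a1] x1 xa d1 Q0 /andP[q0 qQ] dQ; apply: le_trans.
have x0 : 0 < x by rewrite (lt_le_trans ltr01).
have d0 : 0 < d by rewrite (lt_le_trans ltr01).
have qp0 : 0 < q `^ (3 / 2 + alpha) by rewrite powR_gt0.
rewrite ler_pdivlMr//.
have e0 : 0 <= 3 / 2 + alpha by lra.
have q_pow : q `^ (3 / 2 + alpha) <= 4 * Q `^ (3 / 2 + alpha).
  apply: (@le_trans _ _ ((2 * Q) `^ (3 / 2 + alpha))).
    by apply: ge0_ler_powR; rewrite ?nnegrE//; lra.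
  rewrite powRM ?(ltW Q0)// ler_wpM2r ?powR_ge0//.
  apply: (@le_trans _ _ (2 `^ 2%:R)); first by rewrite ler_powR ?ler1n//; lra.
  by rewrite powR_mulrn//; lra.
have dQ_pow : d * Q `^ (3 / 2 + alpha) <= x `^ (1 - 5 * alpha).
  apply: (@le_trans _ _ ((d ^+ 2 * Q) `^ (3 / 2 + alpha))).
    rewrite powRM ?(ltW Q0) ?exprn_ge0 ?(ltW d0)// ler_wpM2r ?powR_ge0//.
    apply: (@le_trans _ _ (d ^+ 2)); first by rewrite expr2 ler_peMl// ltW.
    by apply: le1r_powR; rewrite ?exprn_ege1//; lra.
  apply: (@le_trans _ _ ((x `^ (2 / 3 - 4 * alpha)) `^ (3 / 2 + alpha))).
    apply: ge0_ler_powR; rewrite ?nnegrE ?powR_ge0// ?ltW//.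
    by rewrite mulr_gt0 ?exprn_gt0.
  by rewrite -powRrM ler_powR//; nra.
have {2}-> : x = x `^ (4 * alpha) * (x `^ alpha * x `^ (1 - 5 * alpha)).
  by rewrite -!powRDp// -[LHS](powRr1 (ltW x0)); congr powR; ring.
rewrite -mulrA ler_wpM2l ?powR_ge0//.
apply: (@le_trans _ _ (4 * (d * Q `^ (3 / 2 + alpha)))).
  by rewrite mulrCA ler_wpM2l// ltW.
by apply: ler_pM => //; rewrite mulr_ge0 ?powR_ge0// ltW.
Qed.

Lemma powR_exprn (R : realType) (x r : R) (n : nat) :
  (x `^ r) ^+ n = x `^ (r * n%:R).
Proof. by rewrite powRrM powR_mulrn ?powR_ge0. Qed.

(** [U] and [V] are the two terms of the target; their fourth powers are x M2 times M2^4 / Q and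
    M2^2, the two terms of the energy bound. [Z] bounds both the divisor function and the harmonic
    sum, and it enters five times: three in the cube and two in the next factor. *)
Lemma error_bound_le (R : realType) (D T3 E : nat) (H tau L Z C : R)
    (alpha kappa x Q M1 M2 M3 : R) :
    (0 < D)%N -> 0 < Q -> 0 < x -> 0 < M3 -> M3 <= M2 -> M2 <= M1 ->
    M1 * M2 * M3 <= x -> 1 <= Z -> 0 <= H <= Z -> 0 <= tau <= Z ->
    T3%:R <= 4 * M3 -> 0 <= L <= 2 * M1 -> 1 <= C ->
    Z ^+ 5 <= C * Q `^ (4 * alpha) ->
    E%:R <= Q `^ (4 * kappa + 4 * alpha) * (M2 ^+ 2 + M2 ^+ 4 / Q) ->
  error_bound D T3 H tau L E <= 20 * 16 ^+ 3 * C *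
    (D%:R ^+ 3 * ((M2 `^ (5 / 4) * x `^ (1 / 4) * Q `^ (- (1 / 4)) +
                   M2 `^ (3 / 4) * x `^ (1 / 4)) * Q `^ (2 * alpha + kappa))).
Proof.
move=> D_gt0 Q0 x0 M30 M32 M21 Mx Z1 /andP[H0 HZ] /andP[tau0 tauZ] T3M /andP[L0 LM].
move=> C1 ZC EE.
have [B BE] : exists B : R, B = 20 * 16 ^+ 3 by exists (20 * 16 ^+ 3).
have B1 : 1 <= B by rewrite BE mulr_ege1 ?exprn_ege1 ?ler1n.
have BC1 : 1 <= B * C by rewrite mulr_ege1.
rewrite -BE.
have D1 : 1 <= D%:R :> R by rewrite ler1n.
have M20 : 0 < M2 by exact: lt_le_trans M32.
have M10 : 0 < M1 by exact: lt_le_trans M21.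
have Z0 : 0 <= Z by lra.
set U := M2 `^ (5 / 4) * _ * _; set V := M2 `^ (3 / 4) * _.
have U0 : 0 <= U by rewrite !mulr_ge0 ?powR_ge0.
have V0 : 0 <= V by rewrite !mulr_ge0 ?powR_ge0.
set P := Q `^ (2 * alpha + kappa); have P0 : 0 <= P by exact: powR_ge0.
have U4 : U ^+ 4 = x * M2 * (M2 ^+ 4 / Q).
  rewrite /U !exprMn !powR_exprn.
  have -> : 5 / 4 * 4%:R = 5%:R :> R by lra.
  have -> : 1 / 4 * 4%:R = 1 :> R by lra.
  have -> : - (1 / 4) * 4%:R = -1 :> R by lra.
  rewrite powR_mulrn ?(ltW M20)// powRr1 ?(ltW x0)// powR_inv1 ?(ltW Q0)//.
  by rewrite exprS; ring.
have V4 : V ^+ 4 = x * M2 * M2 ^+ 2.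
  rewrite /V !exprMn !powR_exprn.
  have -> : 3 / 4 * 4%:R = 3%:R :> R by lra.
  have -> : 1 / 4 * 4%:R = 1 :> R by lra.
  rewrite powR_mulrn ?(ltW M20)// powRr1 ?(ltW x0)//.
  by rewrite exprS; ring.
clearbody U V.
have UV4 : U ^+ 4 + V ^+ 4 <= (U + V) ^+ 4.
  rewrite -subr_ge0.
  have -> : (U + V) ^+ 4 - (U ^+ 4 + V ^+ 4) =
      4 * U ^+ 3 * V + 6 * U ^+ 2 * V ^+ 2 + 4 * U * V ^+ 3 by ring.
  by rewrite !addr_ge0// !mulr_ge0 ?exprn_ge0.
have P4 : P ^+ 4 = Q `^ (4 * alpha) * Q `^ (4 * kappa + 4 * alpha).
  by rewrite powR_exprn -powRDp//; congr powR; ring.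
clearbody P.
rewrite /error_bound; set Y := _ * _ * _.
(* The constant is kept whole: as B C >= 1, it is at most its own fourth power. *)
pose W := B * C * D%:R * ((U + V) * P).
have W0 : 0 <= W by apply: mulr_ge0; apply: mulr_ge0; rewrite ?addr_ge0//; lra.
have YW : Y <= W ^+ 4.
  have Y1 : (4 * D%:R * H * T3%:R) ^+ 3 <= (16 * D%:R * Z * M3) ^+ 3.
    rewrite lerXn2r ?nnegrE ?mulr_ge0 ?(ltW M30)//.
    have -> : 16 * D%:R * Z * M3 = 4 * D%:R * Z * (4 * M3) by ring.
    apply: ler_pM; rewrite ?mulr_ge0//.
    by rewrite ler_wpM2l ?mulr_ge0.
  have Y2 : 2 * tau * (L + 2 * D%:R * T3%:R * H) <= 2 * Z * (10 * D%:R * Z * M1).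
    apply: ler_pM; rewrite ?mulr_ge0 ?addr_ge0 ?mulr_ge0//.
      by rewrite ler_wpM2l.
    have a1 : 2 * M1 <= 2 * (D%:R * Z * M1).
      rewrite ler_wpM2l// ler_peMl ?(ltW M10)//.
      by rewrite mulr_ege1.
    have a2 : 2 * D%:R * T3%:R * H <= 2 * D%:R * (4 * M1) * Z.
      apply: ler_pM; rewrite ?mulr_ge0//.
      rewrite ler_wpM2l ?mulr_ge0//; apply: le_trans T3M _.
      by rewrite ler_wpM2l// (le_trans M32).
    have -> : 10 * D%:R * Z * M1 = 2 * (D%:R * Z * M1) + 2 * D%:R * (4 * M1) * Z by ring.
    by rewrite lerD// (le_trans LM).
  have Y3 : M3 ^+ 3 * M1 <= x * M2.
    rewrite -(ler_pM2r M20).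
    have -> : M3 ^+ 3 * M1 * M2 = M1 * M2 * M3 * (M3 * M3) by ring.
    rewrite -[leRHS]mulrA; apply: ler_pM; rewrite ?mulr_ge0 ?(ltW M10) ?(ltW M20) ?(ltW M30)//.
    by apply: ler_pM; rewrite ?(ltW M30).
  have Qp0 : 0 <= Q `^ (4 * kappa + 4 * alpha) by exact: powR_ge0.
  have S0 : 0 <= M2 ^+ 2 + M2 ^+ 4 / Q.
    by rewrite addr_ge0 ?divr_ge0 ?exprn_ge0 ?(ltW M20) ?(ltW Q0).
  apply: (@le_trans _ _ (B * D%:R ^+ 4 * (C * Q `^ (4 * alpha)) * (x * M2) *
     (Q `^ (4 * kappa + 4 * alpha) * (M2 ^+ 2 + M2 ^+ 4 / Q)))).
    apply: ler_pM => //.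
      by rewrite !mulr_ge0 ?exprn_ge0 ?addr_ge0 ?mulr_ge0.
    apply: (@le_trans _ _ ((16 * D%:R * Z * M3) ^+ 3 * (2 * Z * (10 * D%:R * Z * M1)))).
      by apply: ler_pM; rewrite ?exprn_ge0 ?mulr_ge0 ?addr_ge0 ?mulr_ge0.
    have -> : (16 * D%:R * Z * M3) ^+ 3 * (2 * Z * (10 * D%:R * Z * M1)) =
       B * D%:R ^+ 4 * Z ^+ 5 * (M3 ^+ 3 * M1) by rewrite BE; ring.
    have B0 : 0 <= B by lra.
    apply: ler_pM; rewrite ?mulr_ge0 ?exprn_ge0 ?(ltW M10) ?(ltW M30)//.
    by rewrite ler_wpM2l ?mulr_ge0 ?exprn_ge0.
  have -> : B * D%:R ^+ 4 * (C * Q `^ (4 * alpha)) * (x * M2) *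
     (Q `^ (4 * kappa + 4 * alpha) * (M2 ^+ 2 + M2 ^+ 4 / Q)) =
     B * C * (D%:R ^+ 4 * P ^+ 4 * (U ^+ 4 + V ^+ 4)).
    by rewrite P4 U4 V4; ring.
  have -> : W ^+ 4 = (B * C) ^+ 4 * (D%:R ^+ 4 * P ^+ 4 * (U + V) ^+ 4).
    by rewrite /W; ring.
  apply: ler_pM.
  - by lra.
  - by rewrite !mulr_ge0 ?exprn_ge0 ?addr_ge0 ?exprn_ge0.
  - by rewrite -{1}[B * C]expr1 ler_weXn2l.
  - by rewrite ler_wpM2l ?mulr_ge0 ?exprn_ge0.
have Y14 : Y `^ (1 / 4) <= W.
  have [Y0|Y0] := leP 0 Y; last first.
    suff : 0 <= Y by rewrite leNgt Y0.
    by rewrite !mulr_ge0 ?exprn_ge0 ?addr_ge0 ?mulr_ge0.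
  have -> : W = (W ^+ 4) `^ (1 / 4).
    by rewrite -powR_mulrn// -powRrM mulrCA divff ?mulr1 ?powRr1.
  by apply: ge0_ler_powR; rewrite ?nnegrE ?exprn_ge0// divr_ge0.
apply: (@le_trans _ _ (D%:R * W)); first by rewrite ler_wpM2l.
have -> : D%:R * W = B * C * (D%:R ^+ 2 * ((U + V) * P)) by rewrite /W; ring.
apply: ler_wpM2l; first by lra.
rewrite ler_wpM2r ?mulr_ge0 ?addr_ge0//.
by rewrite ler_weXn2l.
Qed.

Lemma nceil_lt (R : realType) (x : R) : 0 < x -> (nceil x)%:R < x + 1.
Proof.
move=> x0; have := ceilB1_lt x; rewrite -nceilE// intrD rmorphN1 -pmulrn.
by lra.
Qed.

Lemma nceil_gt0 (R : realType) (x : R) : 0 < x -> (0 < nceil x)%N.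
Proof. by move=> x0; rewrite -(ltr_nat R) (lt_le_trans x0)// nceil_ge. Qed.

Lemma nceil_short (R : realType) (M Delta : R) : 0 < M -> 0 < Delta <= 1 ->
  (nceil M <= nceil (M * (1 + Delta)) <= 2 * nceil M)%N.
Proof.
move=> M0 /andP[d0 d1]; have M'0 : 0 < M * (1 + Delta) by rewrite mulr_gt0//; lra.
rewrite !nceil_le//; apply/andP; split.
  by apply: le_trans (nceil_ge M'0); nra.
by rewrite natrM; have := nceil_ge M0; nra.
Qed.

Lemma markov_card (R : realType) (s : seq nat) (w : nat -> R) (t B : R) :
    0 < t -> (forall q, 0 <= w q) -> \sum_(q <- s) w q <= B ->
  (size [seq q <- s | t < w q])%:R <= B / t.
Proof.
move=> t0 w0 sB; rewrite ler_pdivlMr//; apply: le_trans sB.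
rewrite -[leLHS](sumr_const_seq [seq q <- s | t < w q] t).
rewrite big_filter big_mkcond/=; apply: ler_sum => q _.
by case: ifP => // /ltW.
Qed.

Lemma width_le1 (R : realType) (c x Delta : R) : 0 < c -> 0 < x ->
  expR (1 + c) <= x -> Delta <= c / ln x ^+ 8 -> Delta <= 1.
Proof.
move=> c0 x0 xc /le_trans; apply.
have lnx : 1 + c <= ln x by rewrite -ler_expR lnK ?posrE.
have ln1 : 1 <= ln x by lra.
have ln8 : 0 < ln x ^+ 8 by apply: exprn_gt0; lra.
rewrite ler_pdivrMr// mul1r.
apply: (@le_trans _ _ (ln x)); first lra.
by rewrite -{1}[ln x]expr1 ler_weXn2l.
Qed.

Lemma powR_ge1 (R : realType) (x r : R) : 1 <= x -> 0 <= r -> 1 <= x `^ r.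
Proof. by move=> x1 r0; have := ler_powR x1 r0; rewrite powRr0. Qed.

Lemma parameter_ranges (R : realType) (alpha x Q M2 M3 d q : R) :
    0 < alpha < 1 / 100 -> 2 ^+ 100 <= x -> 4 <= x `^ alpha -> 1 <= d ->
    0 < Q -> 1 <= q <= 2 * Q -> x / q `^ (3 / 2 + alpha) <= M3 -> M3 <= M2 ->
    M2 <= x `^ (1 / 3) -> d ^+ 2 * Q < x `^ (2 / 3 - 4 * alpha) ->
  [/\ x `^ (2 / 5) <= Q, 1 <= Q <= x, d * Q <= x `^ (2 / 3),
      x `^ (4 * alpha) * d <= M3 & 1 <= M3].
Proof.
move=> ha xbig xa d1 Q0 /andP[q1 qQ] xM3 M32 M2x dQ.
have := modulus_lower_bound ha xbig q1 xM3 (le_trans M32 M2x).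
have x1 : 1 <= x by apply: le_trans xbig; rewrite exprn_ege1// ler1n.
clear xbig => qx.
have Qx : x `^ (2 / 5) <= Q by lra.
have Q1 : 1 <= Q by apply: le_trans Qx; apply: powR_ge1 => //; lra.
have dQ' : d * Q <= x `^ (2 / 3).
  apply: (@le_trans _ _ (d ^+ 2 * Q)).
    by rewrite ler_wpM2r ?(ltW Q0)// expr2 ler_peMl//; lra.
  by apply: (le_trans (ltW dQ)); rewrite ler_powR//; lra.
have QQ : Q <= x.
  apply: (@le_trans _ _ (x `^ (2 / 3))); last by rewrite ler1_powR//; lra.
  by apply: le_trans dQ'; rewrite ler_peMl// ltW.
have M3D : x `^ (4 * alpha) * d <= M3.
  apply: (third_factor_lower_bound ha x1 xa d1 Q0 _ dQ xM3).
  by rewrite qQ andbT; lra.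
split=> //; first by rewrite Q1.
apply: le_trans M3D; rewrite mulr_ege1// powR_ge1//; lra.
Qed.

(** This and [energy_size] place every integer to which the divisor bound will be applied below x^3,
    so that one constant serves all of them. *)
Lemma modulus_size (R : realType) (x Q M3 : R) (q D A3 : nat) :
    2 ^+ 100 <= x -> q%:R <= 2 * Q -> D%:R * Q <= x `^ (2 / 3) ->
    M3 <= x `^ (1 / 3) -> A3%:R <= 2 * M3 ->
  (q * D * (2 * A3))%:R <= x ^+ 3.
Proof.
move=> xbig qQ DQ M3x A3M.
have x1 : 1 <= x by apply: le_trans xbig; rewrite exprn_ege1// ler1n.
have x8 : 2 ^+ 3 <= x by apply: le_trans xbig; rewrite ler_weXn2l ?ler1n.
clear xbig; have x0 : 0 < x by lra.
apply: (@le_trans _ _ (x * x)); last by rewrite [leRHS]exprS ler_wpM2l ?(ltW x0)// expr2 ler_peMl// ltW.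
apply: (@le_trans _ _ (2 ^+ 3 * x)); last by rewrite ler_wpM2r// ltW.
have -> : 2 ^+ 3 * x = 2 * x `^ (2 / 3) * (4 * x `^ (1 / 3)).
  have {1}-> : x = x `^ (2 / 3) * x `^ (1 / 3).
    by rewrite -powRDp// -[LHS](powRr1 (ltW x0)); congr powR; lra.
  by ring.
rewrite natrM natrM [(2 * A3)%:R]natrM; apply: ler_pM => //.
  apply: (@le_trans _ _ (2 * Q * D%:R)); first by rewrite ler_wpM2r.
  by rewrite -mulrA ler_wpM2l// mulrC.
by lra.
Qed.

Lemma energy_size (R : realType) (x M2 : R) (A2 : nat) :
    2 ^+ 100 <= x -> 0 < M2 -> M2 <= x `^ (1 / 3) -> A2%:R <= 2 * M2 ->
  (2 * (2 * A2) ^ 4)%:R <= x ^+ 3.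
Proof.
move=> xbig M20 M2x A2M.
have x1 : 1 <= x by apply: le_trans xbig; rewrite exprn_ege1// ler1n.
have x9 : 2 ^+ 9 <= x by apply: le_trans xbig; rewrite ler_weXn2l ?ler1n.
clear xbig; have x0 : 0 <= x by exact: le_trans x1.
rewrite natrM natrX natrM.
apply: (@le_trans _ _ (2 * (4 * M2) ^+ 4)).
  rewrite ler_wpM2l// lerXn2r ?nnegrE ?mulr_ge0 ?(ltW M20)//.
  apply: (@le_trans _ _ (2 * (2 * M2))); first by rewrite ler_wpM2l.
  by clear x9; lra.
have -> : 2 * (4 * M2) ^+ 4 = 2 ^+ 9 * M2 ^+ 4 by ring.
rewrite [leRHS]exprS; apply: ler_pM; rewrite ?exprn_ge0 ?(ltW M20)//.
apply: (@le_trans _ _ ((x `^ (1 / 3)) ^+ 4)).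
  by rewrite lerXn2r ?nnegrE ?powR_ge0// ltW.
rewrite powR_exprn -[leRHS]powR_mulrn// ler_powR//.
by clear x9; lra.
Qed.

(** The energies sum to at most 16 Z Q (M2^2 + M2^4 / Q); the factor Q^(4 alpha) of the threshold
    absorbs 16 Z, and Q^(4 kappa) is the gain. *)
Lemma exceptional_moduli_le (R : realType) (alpha kappa Q M2 Z : R) (A2 B2 : nat) :
    1 <= Q -> 0 < M2 -> 0 <= Z -> 16 * Z <= Q `^ (4 * alpha) ->
    (0 < A2)%N -> (B2 <= 2 * A2)%N -> A2%:R <= 2 * M2 ->
    (forall m, (0 < m <= 2 * (2 * A2) ^ 4)%N -> (size (divisors m))%:R <= Z) ->
  (size [seq q <- index_iota (nceil Q) (nceil (2 * Q)).+1 |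
      Q `^ (4 * kappa + 4 * alpha) * (M2 ^+ 2 + M2 ^+ 4 / Q) <
      (energy q (index_iota A2 B2))%:R])%:R <= Q `^ (1 - 4 * kappa).
Proof.
move=> Q1 M20 Z0 ZQ A2_gt0 BA2 A2M tauP.
have Q0 : 0 < Q by lra.
set thr := _ * _; set I2 := index_iota A2 B2; set qs := index_iota _ _.
have S0 : 0 < M2 ^+ 2 + M2 ^+ 4 / Q.
  by rewrite addr_gt0 ?divr_gt0 ?exprn_gt0.
have thr0 : 0 < thr by rewrite mulr_gt0 ?powR_gt0.
have sI2 : (size I2)%:R <= 2 * M2.
  by apply: le_trans A2M; rewrite ler_nat size_iota; lia.
(* Rounding at both ends leaves fewer than Q + 2 moduli, hence at most 3 Q as Q >= 1. *)
have sqs : (size qs)%:R <= 3 * Q.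
  have Q20 : 0 < 2 * Q by lra.
  have u := nceil_lt Q20; have v := nceil_ge Q0; have w := nceil_ge Q20.
  rewrite size_iota natrB; last first.
    by rewrite nceil_le// -[_.+1%:R]natr1; lra.
  by rewrite -[(nceil (2 * Q)).+1%:R]natr1; lra.
have sumE : \sum_(q <- qs) (energy q I2)%:R <= 16 * Z * Q * (M2 ^+ 2 + M2 ^+ 4 / Q).
  apply: le_trans (@sum_energy_le R qs I2 (2 * A2) Z _ _ _ Z0 tauP) _;
    rewrite ?iota_uniq//.
    move=> t; rewrite mem_index_iota => /andP[At tB].
    by rewrite (leq_trans A2_gt0 At) (leq_trans (ltnW tB) BA2).
  have n4 : (size I2)%:R ^+ 4 <= 16 * M2 ^+ 4.
    have -> : 16 * M2 ^+ 4 = (2 * M2) ^+ 4 by ring.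
    by rewrite lerXn2r ?nnegrE ?mulr_ge0 ?(ltW M20).
  have n2 : (size I2)%:R ^+ 2 <= 4 * M2 ^+ 2.
    have -> : 4 * M2 ^+ 2 = (2 * M2) ^+ 2 by ring.
    by rewrite lerXn2r ?nnegrE ?mulr_ge0 ?(ltW M20).
  have n2q : (size I2)%:R ^+ 2 * (size qs)%:R <= 4 * M2 ^+ 2 * (3 * Q).
    by apply: ler_pM; rewrite ?exprn_ge0.
  have -> : 16 * Z * Q * (M2 ^+ 2 + M2 ^+ 4 / Q) =
      Z * (16 * (M2 ^+ 2 * Q) + 16 * M2 ^+ 4) by field; rewrite gt_eqF.
  rewrite ler_wpM2l//.
  have : 0 <= M2 ^+ 2 * Q by rewrite mulr_ge0 ?exprn_ge0 ?(ltW M20)// ltW.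
  by lra.
apply: le_trans (markov_card thr0 (fun=> ler0n _ _) sumE) _.
rewrite ler_pdivrMr// /thr mulrA -powRDp//.
have -> : 1 - 4 * kappa + (4 * kappa + 4 * alpha) = 1 + 4 * alpha by ring.
rewrite powRDp// powRr1 ?(ltW Q0)// ler_wpM2r ?(ltW S0)//.
by rewrite [leRHS]mulrC ler_wpM2r// ltW.
Qed.

(** Both [X] and Q^(alpha / 2) are at most x^alpha, so their product with [d] is at most [M3], and
    M1 M2 M3 <= x finishes. *)
Lemma main_term_le (R : realType) (alpha x Q M1 M2 M3 G X q a1 a2 d : R) :
    0 < alpha -> 1 <= x -> 1 <= Q -> Q <= x -> Q <= q -> 0 <= G ->
    0 <= X <= x `^ alpha -> 0 <= d -> x `^ (4 * alpha) * d <= M3 ->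
    0 < M1 -> 0 < M2 -> M1 * M2 * M3 <= x ->
    0 <= a1 <= 2 * M1 -> 0 <= a2 <= 2 * M2 ->
  a1 / q * (d * (G * X) * a2) <= 4 * G * (x / Q `^ (1 + alpha / 2)).
Proof.
move=> al0 x1 Q1 Qx Qq G0 /andP[X0 Xa] d0 M3d M10 M20 Mx /andP[a10 a1M] /andP[a20 a2M].
have x0 : 0 < x by lra.
have Q0 : 0 < Q by lra.
have q0 : 0 < q by lra.
have Qa : Q `^ (alpha / 2) <= x `^ alpha.
  apply: (@le_trans _ _ (x `^ (alpha / 2))).
    by apply: ge0_ler_powR; rewrite ?nnegrE ?(ltW x0) ?(ltW Q0)//; lra.
  by rewrite ler_powR//; lra.
have key : X * Q `^ (alpha / 2) * d <= M3.
  apply: le_trans M3d; rewrite ler_wpM2r//.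
  apply: (@le_trans _ _ (x `^ alpha * x `^ alpha)).
    by apply: ler_pM; rewrite ?powR_ge0.
  by rewrite -powRDp// ler_powR//; lra.
apply: (@le_trans _ _ (2 * M1 / Q * (d * (G * X) * (2 * M2)))).
  apply: ler_pM; rewrite ?divr_ge0 ?mulr_ge0 ?(ltW q0)//.
    apply: ler_pM; rewrite ?invr_ge0 ?(ltW q0)//.
    by rewrite lef_pV2 ?posrE.
  by rewrite ler_wpM2l ?mulr_ge0.
rewrite powRDp// powRr1 ?(ltW Q0)//.
have Qa0 : 0 < Q `^ (alpha / 2) by rewrite powR_gt0.
have -> : 2 * M1 / Q * (d * (G * X) * (2 * M2)) =
    4 * G * (X * Q `^ (alpha / 2) * d * (M1 * M2) / (Q * Q `^ (alpha / 2))).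
  by field; rewrite !gt_eqF.
rewrite ler_wpM2l ?mulr_ge0//.
rewrite ler_wpM2r ?invr_ge0 ?mulr_ge0 ?(ltW Q0) ?(ltW Qa0)//.
apply: le_trans Mx; rewrite [leRHS]mulrC ler_wpM2r//.
by rewrite mulr_ge0// ltW.
Qed.

Lemma nceil_le2 (R : realType) (x : R) : 1 <= x -> (nceil x)%:R <= 2 * x.
Proof.
move=> x1; have x0 : 0 < x by lra.
by have := nceil_lt x0; lra.
Qed.

Theorem lemma13p2 (R : realType) (alpha kappa c : R)
    (halpha : 0 < alpha < 1 / 100) (hkappa : 0 < kappa) (hc : 0 < c) :
  exists (o1 : R -> R) (K : R -> R) (x0 : R),
    (o1 Q @[Q --> +oo] --> 0) /\
    forall (x Q C : R) (D : nat) (chi : int -> R) (M1 M2 M3 Delta : R)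
           (f1 f2 f3 : int -> R),
      x0 <= x ->
      0 < Q ->
      0 < C < 1 ->
      exceptional_character C D chi ->
      exactly_one_is chi f1 f2 f3 ->
      0 < Delta <= c / ln x ^+ 8 ->
      x / ln x ^+ 12 < M1 * M2 * M3 <= x ->
      (forall q : nat, Q <= q%:R <= 2 * Q ->
         [/\ x / q%:R `^ (3 / 2 + alpha) <= M3, M3 <= M2, M2 <= M1
           & M1 <= D%:R * q%:R `^ (1 + alpha)]) ->
      D%:R ^+ 2 * Q < x `^ (2 / 3 - 4 * alpha) ->
      M2 <= x `^ (1 / 3) ->
      exists E : {fset nat},
        #|` E|%:R <= Q `^ (1 - 4 * kappa + o1 Q) /\
        forall q : nat, Q <= q%:R <= 2 * Q -> q \notin E ->
          forall epsilon : R, 0 < epsilon < alpha / 4 ->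
            max_ternary_sum M1 M2 M3 Delta f1 f2 f3 q <=
            K epsilon *
              (D%:R ^+ 3 * x `^ epsilon *
                 (M2 `^ (5 / 4) * x `^ (1 / 4) * Q `^ (- (1 / 4)) +
                  M2 `^ (3 / 4) * x `^ (1 / 4)) *
                 Q `^ (2 * alpha + kappa) +
               x / Q `^ (1 + alpha / 2)).
Proof.
have /andP[a0 a1] := halpha.
(* Divisor and harmonic sums cost X = x^(3 d) each. This [d] is small enough for both X^5 and
   x^alpha X to stay below x^(8 alpha / 5), which is at most Q^(4 alpha). *)
pose d := alpha / 100.
have d0 : 0 < d by rewrite divr_gt0.
have [C1 C1_ge1 C1P] := size_divisors_le_powR d0.
pose G := C1 + (1 + d^-1).
have dV : 0 < d^-1 by rewrite invr_gt0.
have C1G : C1 <= G by rewrite /G; lra.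
have HG : 1 + d^-1 <= G by rewrite /G; lra.
have G1 : 1 <= G by exact: le_trans C1G.
have G0 : 0 <= G by exact: le_trans G1.
have G5 : 1 <= G ^+ 5 by rewrite exprn_ege1.
pose K1 := 20 * 16 ^+ 3 * G ^+ 5; pose K2 := 4 * G.
have K10 : 0 <= K1 by rewrite !mulr_ge0 ?exprn_ge0.
have K20 : 0 <= K2 by rewrite mulr_ge0.
(* The three summands of the threshold give 2 <= x^(1/100), Delta <= 1 and 16 G <= x^alpha
   respectively. *)
exists (fun=> 0), (fun=> K1 + K2), (2 ^+ 100 + expR (1 + c) + (16 * G) `^ alpha^-1).
split; first exact: cvg_cst.
move=> x Q C D chi M1 M2 M3 Delta f1 f2 f3 xx0 Q0 _ [hchi hquad hprim _] one.
move=> /andP[Delta0 Delta_le] /andP[_ Mx] Mq DQ M2x.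
(* The size conditions on the [M]s are stated per modulus, so a modulus in range is needed to
   exploit them; without one the claim is vacuous. *)
have [[q1 q1Q]|noq] := pselect (exists q : nat, Q <= q%:R <= 2 * Q); last first.
  exists fset0; split; first by rewrite cardfs0 powR_ge0.
  by move=> q qQ; case: noq; exists q.
have [x_big x_exp x_G] :
    [/\ 2 ^+ 100 <= x, expR (1 + c) <= x & (16 * G) `^ alpha^-1 <= x].
  have p1 : 0 <= 2 ^+ 100 :> R by rewrite exprn_ge0.
  have p2 := expR_ge0 (1 + c); have p3 := powR_ge0 (16 * G) alpha^-1.
  split; apply: le_trans xx0.
  - by rewrite -addrA lerDl addr_ge0.
  - by rewrite addrAC lerDr addr_ge0.
  - by rewrite lerDr addr_ge0.
have x1 : 1 <= x by apply: le_trans x_big; rewrite exprn_ege1// ler1n.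
have x0 : 0 < x by exact: lt_le_trans x1.
have xa : 16 * G <= x `^ alpha.
  have {1}-> : 16 * G = ((16 * G) `^ alpha^-1) `^ alpha.
    by rewrite -powRrM mulVf ?gt_eqF// powRr1// mulr_ge0.
  by apply: ge0_ler_powR; rewrite ?nnegrE ?powR_ge0// ltW.
have xa4 : 4 <= x `^ alpha.
  by apply: le_trans xa; clear - G1; lra.
have Delta1 : 0 < Delta <= 1.
  by rewrite Delta0 (width_le1 hc x0 x_exp Delta_le).
have D_gt0 : (0 < D)%N by case: hchi.
have D1 : 1 <= D%:R :> R by rewrite ler1n.
have [xM3 M32 M21 _] := Mq _ q1Q.
have q1Q' : 1 <= (q1%:R : R) <= 2 * Q.
  have /andP[Qq qQ2] := q1Q; apply/andP; split=> //.
  by rewrite ler1n -(ltr_nat R) (lt_le_trans Q0).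
have [Qx /andP[Q1 QX] DQx M3D M31] :=
  parameter_ranges halpha x_big xa4 D1 Q0 q1Q' xM3 M32 M2x DQ.
have M30 : 0 < M3 by exact: lt_le_trans M31.
have M20 : 0 < M2 by exact: lt_le_trans M32.
have M10 : 0 < M1 by exact: lt_le_trans M21.
have M2_1 : 1 <= M2 by exact: le_trans M32.
have M1_1 : 1 <= M1 by exact: le_trans M21.
have M3x : M3 <= x `^ (1 / 3) by exact: le_trans M2x.
pose A1 := nceil M1; pose B1 := nceil (M1 * (1 + Delta)).
pose A2 := nceil M2; pose B2 := nceil (M2 * (1 + Delta)).
pose A3 := nceil M3; pose B3 := nceil (M3 * (1 + Delta)).
have /andP[AB1 BA1] : (A1 <= B1 <= 2 * A1)%N := nceil_short M10 Delta1.
have /andP[AB2 BA2] : (A2 <= B2 <= 2 * A2)%N := nceil_short M20 Delta1.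
have /andP[AB3 BA3] : (A3 <= B3 <= 2 * A3)%N := nceil_short M30 Delta1.
have A1M : A1%:R <= 2 * M1 := nceil_le2 M1_1.
have A2M : A2%:R <= 2 * M2 := nceil_le2 M2_1.
have A3M : A3%:R <= 2 * M3 := nceil_le2 M31.
have A2_gt0 : (0 < A2)%N by exact: nceil_gt0.
have A3_gt0 : (0 < A3)%N by exact: nceil_gt0.
have A32 : (A3 <= A2)%N by rewrite nceil_le// (le_trans M32)// nceil_ge.
pose X := x `^ (3%:R * d); pose Z := G * X.
have X1 : 1 <= X by rewrite powR_ge1// mulr_ge0// ltW.
have X0 : 0 <= X by exact: le_trans X1.
have Z1 : 1 <= Z by rewrite mulr_ege1.
have Z0 : 0 <= Z by exact: le_trans Z1.
have powX (m : nat) : m%:R <= x ^+ 3 -> m%:R `^ d <= X.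
  move=> mx; have -> : X = (x ^+ 3) `^ d by rewrite /X powRrM powR_mulrn// ltW.
  by apply: ge0_ler_powR; rewrite ?nnegrE ?exprn_ge0 ?(ltW x0) ?(ltW d0).
have tau_small (m : nat) : (0 < m)%N -> m%:R <= x ^+ 3 ->
    (size (divisors m))%:R <= Z.
  move=> m_gt0 mx; apply: le_trans (C1P _ m_gt0) _.
  by apply: ler_pM; rewrite ?powR_ge0 ?powX// (le_trans ler01).
have Xa : X <= x `^ alpha by rewrite ler_powR// /d; clear - a0; lra.
have QaQ : x `^ (2 / 5 * (4 * alpha)) <= Q `^ (4 * alpha).
  rewrite (powRrM x (2 / 5)); apply: ge0_ler_powR => //.
  - by rewrite mulr_ge0// ltW.
  - by rewrite nnegrE powR_ge0.
  - by rewrite nnegrE ltW.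
have Z5Q : Z ^+ 5 <= G ^+ 5 * Q `^ (4 * alpha).
  rewrite exprMn ler_wpM2l ?exprn_ge0//; apply: le_trans QaQ.
  by rewrite powR_exprn ler_powR// /d; clear - a0; lra.
have ZQ : 16 * Z <= Q `^ (4 * alpha).
  apply: (@le_trans _ _ (x `^ alpha * X)); first by rewrite mulrA ler_wpM2r.
  apply: le_trans QaQ; rewrite /X -powRDp// ler_powR// /d; clear - a0; lra.
pose thr := Q `^ (4 * kappa + 4 * alpha) * (M2 ^+ 2 + M2 ^+ 4 / Q).
pose I2 := index_iota A2 B2.
pose bad := [seq q <- index_iota (nceil Q) (nceil (2 * Q)).+1 |
  thr < (energy q I2)%:R].
exists [fset q in bad]%fset; split.
  rewrite card_fseq undup_id ?filter_uniq ?iota_uniq// addr0.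
  apply: (@exceptional_moduli_le R alpha kappa Q M2 Z A2 B2) => // m /andP[m_gt0 m_le].
  apply: tau_small => //; apply: le_trans (energy_size x_big M20 M2x A2M).
  by rewrite ler_nat.
move=> q qQ; rewrite !inE => q_good epsilon /andP[e0 _].
have /andP[Qq qQ2] := qQ.
have q_gt0 : (0 < q)%N by rewrite -(ltr_nat R) (lt_le_trans Q0).
have Q20 : 0 < 2 * Q by rewrite mulr_gt0.
have Egood : (energy q I2)%:R <= thr.
  rewrite leNgt; apply: contra q_good => bad_q; rewrite mem_filter bad_q /=.
  rewrite mem_index_iota nceil_le// Qq /= ltnS -(ler_nat R).
  by apply: le_trans (nceil_ge Q20).
pose T3 := (2 * A3)%N.
have XX : (q * D * T3)%:R <= x ^+ 3 := modulus_size x_big qQ2 DQx M3x A3M.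
have tauP m : (0 < m <= q * D * T3)%N -> (size (divisors m))%:R <= Z.
  move=> /andP[m_gt0 m_le]; apply: tau_small => //.
  by apply: le_trans XX; rewrite ler_nat.
have X_gt0 : (0 < q * D * T3)%N by rewrite !muln_gt0 q_gt0 D_gt0.
have HZ : harm R (q * D * T3) <= Z.
  apply: le_trans (harm_le_powR d0 X_gt0) _.
  by apply: ler_pM; rewrite ?powR_ge0 ?powX// addr_ge0// ltW.
have xe : 1 <= x `^ epsilon by rewrite powR_ge1// ltW.
set W := _ + M2 `^ (3 / 4) * _.
have W0 : 0 <= W by rewrite addr_ge0 ?mulr_ge0 ?powR_ge0.
set P := Q `^ (2 * alpha + kappa); have P0 : 0 <= P by exact: powR_ge0.
have xQ0 : 0 <= x / Q `^ (1 + alpha / 2) by rewrite divr_ge0 ?powR_ge0// ltW.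
have DWP : 0 <= D%:R ^+ 3 * (W * P) by rewrite mulr_ge0 ?exprn_ge0 ?mulr_ge0.
(* x^epsilon >= 1 can be inserted, since the losses are already paid for in powers of [Q]. *)
have DWPx : D%:R ^+ 3 * (W * P) <= D%:R ^+ 3 * x `^ epsilon * W * P.
  have -> : D%:R ^+ 3 * x `^ epsilon * W * P =
      x `^ epsilon * (D%:R ^+ 3 * (W * P)) by ring.
  by rewrite ler_peMl.
set Bd := (X in _ <= X).
have Bd0 : 0 <= Bd by rewrite mulr_ge0 ?addr_ge0// (le_trans DWP).
have bound : A1%:R / q%:R * (D%:R * Z * A2%:R) +
    error_bound D T3 (harm R (q * D * T3)) Z A1%:R (energy q I2) <= Bd.
  have main : A1%:R / q%:R * (D%:R * Z * A2%:R) <= K2 * (x / Q `^ (1 + alpha / 2)).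
    by apply: (main_term_le a0 x1 Q1 QX Qq G0 _ _ M3D M10 M20 Mx);
      rewrite ?ler0n ?X0.
  have T3M : T3%:R <= 4 * M3.
    by rewrite natrM; clear - A3M; lra.
  have err : error_bound D T3 (harm R (q * D * T3)) Z A1%:R (energy q I2) <=
      K1 * (D%:R ^+ 3 * (W * P)).
    by apply: (error_bound_le D_gt0 Q0 x0 M30 M32 M21 Mx Z1 _ _ T3M _ G5 Z5Q Egood);
      rewrite ?harm_ge0 ?Z0 ?lexx ?ler0n.
  rewrite /Bd mulrDr addrC; apply: lerD.
    by apply: le_trans err _; apply: ler_pM => //; rewrite lerDl.
  by apply: le_trans main _; rewrite ler_wpM2r// lerDr.
(* The maximum starts from 0, whence the need for [Bd0]. *)
rewrite /max_ternary_sum; elim/big_ind: _ => // [y z hy hz|a ca].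
  by rewrite ge_max hy hz.
rewrite ternary_sum_tsum//; apply: le_trans bound.
(* Each upper end is at most twice the lower one, so the ranges have at most [A1], [A2], [A3]
   elements, with A3 <= A2: hence L = A1, N = A2 and T3 = 2 A3. *)
apply: (tsum_bound hchi hquad hprim one q_gt0 AB1 AB2 AB3 A2_gt0 A3_gt0 _ ca
  BA3 _ _ _ tauP).
- by rewrite ler_nat leq_subLR addnn -mul2n.
- by rewrite muln_gt0.
- by rewrite leq_subLR addnn -mul2n.
- by apply: leq_trans A32; rewrite leq_subLR addnn -mul2n.
Qed.
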